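(* Let $p_0$ be a probability mass function (pmf) on $\mathbb{N}=\{0,1,2,\dots\}$ whose support is $\{0,\dots,S\}$ for some integer $S>0$, and assume that $p_0$ is convex on $\mathbb{N}$. Let $X_1,\dots,X_n$ be i.i.d. with pmf $p_0$, let $p_n$ be their empirical pmf, and let $\hat p_n$ be the least-squares projection of $p_n$ onto the set of convex pmfs on $\mathbb{N}$. Then, as $n\to\infty$, $$T_n^2 = n\,\|p_n-\hat p_n\|^2 \xrightarrow{d} \hat T_0:=\sum_{k=0}^{S+1}\big(\hat g_0(k)-g_0(k)\big)^2 ,$$ where $g_0$ and $\hat g_0$ are defined below.
   Context: The empirical pmf is $p_n(j)=n^{-1}\sum_{i=1}^n \mathbb{1}_{\{X_i=j\}}$, $j\in\mathbb{N}$. For a sequence $q=(q(j))_{j\in\mathbb{N}}$, $\|q\|^2=\sum_{j\in\mathbb{N}}q(j)^2$. For a sequence $p$ and $k\geq 1$, $\Delta p(k)=p(k+1)-2p(k)+p(k-1)$; $p$ is convex on $\mathbb{N}$ iff $\Delta p(k)\ge 0$ for all $k\ge 1$. An integer $k\geq1$ is a knot of $p$ if $\Delta p(k)>0$. $\hat p_n$ denotes the (unique) minimizer of $\|p_n-p\|^2$ over all convex pmfs $p$ on $\mathbb{N}$, and $T_n=\sqrt n\,\|p_n-\hat p_n\|$. $g_0=(g_0(0),\dots,g_0(S+1))$ is a centered Gaussian vector in $\mathbb{R}^{S+2}$ with $\mathrm{Cov}(g_0(i),g_0(j))=\mathbb{1}_{\{i=j\}}p_0(i)-p_0(i)p_0(j)$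 for $i,j=0,\dots,S+1$. $\mathcal K_0$ is the set of all $g=(g(0),\dots,g(S+1))\in\mathbb{R}^{S+2}$ such that $\Delta g(k)=g(k+1)-2g(k)+g(k-1)\geq 0$ for all $k\in\{1,\dots,S\}$, with possible exceptions at those $k$ that are knots of $p_0$. $\hat g_0$ is the (unique) minimizer of $\sum_{k=0}^{S+1}(g(k)-g_0(k))^2$ over $g\in\mathcal K_0$. *)

(* Defs.v *)
From HB Require Import structures.
From mathcomp Require Import all_boot all_order all_algebra.
From mathcomp Require Import all_classical all_reals all_analysis.
Set Implicit Arguments. Unset Strict Implicit. Unset Printing Implicit Defensive.
Import Order.TTheory GRing.Theory Num.Theory.
Import numFieldNormedType.Exports.
Local Open Scope classical_set_scope.
Local Open Scope ring_scope.

Section defs.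
Context {R : realType}.

(* second difference; only used for k >= 1 *)
Definition Delta (p : nat -> R) (k : nat) : R := p k.+1 - 2 * p k + p k.-1.

Definition sqnorm (q : nat -> R) : \bar R := (\sum_(0 <= j <oo) ((q j) ^+ 2)%:E)%E.

Definition is_pmf (p : nat -> R) : Prop :=
  (forall j, 0 <= p j) /\ (\sum_(0 <= j <oo) (p j)%:E)%E = 1%E.

Definition convex_seq (p : nat -> R) : Prop := forall k, (1 <= k)%N -> 0 <= Delta p k.

Definition is_knot (p : nat -> R) (k : nat) : Prop := (1 <= k)%N /\ 0 < Delta p k.

(* empirical pmf of X_1..X_n (indexed here X 0 .. X (n-1)) *)
Definition empirical_pmf (T : Type) (X : nat -> T -> nat) (n : nat) (w : T) (j : nat) : R :=
  n%:R^-1 * (\sum_(i < n) ((X i w == j) : nat)%:R).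

Definition is_convex_LSE (q phat : nat -> R) : Prop :=
  [/\ is_pmf phat, convex_seq phat &
      forall p, is_pmf p -> convex_seq p ->
        (sqnorm (fun j => (q j - phat j)%R) <= sqnorm (fun j => (q j - p j)%R))%E].

Definition iid_pmf d (T : measurableType d) (P : probability T R)
  (X : nat -> T -> nat) (p : nat -> R) : Prop :=
  (forall i j, measurable [set w | X i w = j]) /\
  forall (n : nat) (js : nat -> nat),
    P [set w | forall i, (i < n)%N -> X i w = js i] = (\prod_(i < n) p (js i))%:E.

Definition pmf_cov (p : nat -> R) (i j : nat) : R := ((i == j) : nat)%:R * p i - p i * p j.

(* (g 0, ..., g (m-1)) is a centered Gaussian vector with covariance Sigma,
   defined through its characteristic function *)
Definition centered_gaussian_vector d (T : measurableType d) (Q : probability T R)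
  (m : nat) (g : nat -> T -> R) (Sigma : nat -> nat -> R) : Prop :=
  (forall k, (k < m)%N -> measurable_fun setT (g k)) /\
  forall t : nat -> R,
    (\int[Q]_w (cos (\sum_(k < m) t k * g k w))%:E)%E
      = (expR (- (\sum_(i < m) \sum_(j < m) t i * t j * Sigma i j) / 2))%:E
    /\ (\int[Q]_w (sin (\sum_(k < m) t k * g k w))%:E)%E = 0%E.

(* K_0 : vectors g(0..S+1) (stored as nat -> R) convex on {1..S} except at knots of p0 *)
Definition K0 (p0 : nat -> R) (S : nat) : set (nat -> R) :=
  [set g | forall k, (1 <= k <= S)%N -> ~ is_knot p0 k -> 0 <= Delta g k].

Definition is_proj_K0 (p0 : nat -> R) (S : nat) (g0 ghat : nat -> R) : Prop :=
  K0 p0 S ghat /\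
  forall g, K0 p0 S g ->
    \sum_(k < S.+2) (ghat k - g0 k) ^+ 2 <= \sum_(k < S.+2) (g k - g0 k) ^+ 2.

End defs.

(* Main.v *)
Require Import Defs.
From HB Require Import structures.
From mathcomp Require Import all_boot all_order all_algebra.
From mathcomp Require Import all_classical all_reals all_analysis.
From mathcomp Require Import measurable_realfun ring lra.
Import Order.TTheory GRing.Theory Num.Theory.
Import numFieldNormedType.Exports.
Local Open Scope classical_set_scope.
Local Open Scope ring_scope.

(** Write [m = S + 2] and let [dist_K0 x] be the squared distance of
    [x] in [R^m] to the cone [K0].  If [phat] is any convex pmf then [phat - p0]
    lies in [K0], so [|p_n - phat_n|^2 >= dist_K0 (p_n - p0)].  Conversely, let
    [h] be the projection of [p_n - p0] on [K0]: its entries sum to [0] because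
    [K0] contains the line of constants, [h (S + 1) >= 0] because [S + 1] enters
    a single constraint, and [h] is small when [p_n] is close to [p0]; hence
    [p0 + h] is a convex pmf and equality holds.  The cone being homogeneous,
    [T_n^2 = dist_K0 (sqrt n (p_n - p0))] with probability tending to [1].

    The convergence in law of [sqrt n (p_n - p0)] comes from the convergence of
    its characteristic function.  On a box [|x_k| <= L] a continuous function
    is uniformly approximated by Bernstein polynomials in the [sin (x_k / L)];
    these are trigonometric polynomials with the same global bound, so that
    tightness and the limits of [E cos (t . x)] and [E sin (t . x)] suffice. *)

Set Implicit Arguments. Unset Strict Implicit. Unset Printing Implicit Defensive.

(** * Approximation by trigonometric polynomials *)

Section trigonometric_polynomials.
Context {R : realType}.
Variable m : nat.
Implicit Types (t x y : nat -> R) (G H : (nat -> R) -> R).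

Definition dot t x : R := \sum_(k < m) t k * x k.

(** Frequencies are arbitrary real vectors. The class is thus closed under products, and
    expectations of its members are linear combinations of values of characteristic functions. *)
Definition trigpoly G : Prop := exists s : seq (R * R * (nat -> R)),
  forall x, G x = \sum_(c <- s) (c.1.1 * cos (dot c.2 x) + c.1.2 * sin (dot c.2 x)).

Lemma dotD t u x : dot (fun k => t k + u k) x = dot t x + dot u x.
Proof. by rewrite /dot -big_split; apply: eq_bigr => k _; rewrite mulrDl. Qed.

Lemma dotB t u x : dot (fun k => t k - u k) x = dot t x - dot u x.
Proof.
rewrite /dot -sumrN -big_split; apply: eq_bigr => k _.
by rewrite mulrBl.
Qed.

Lemma trigpoly_ext G H : G =1 H -> trigpoly H -> trigpoly G.
Proof. by move=> e [s sE]; exists s => x; rewrite e sE. Qed.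

Lemma trigpoly_cst a : trigpoly (fun=> a).
Proof.
exists [:: ((a, 0), (fun=> 0))] => x; rewrite big_seq1 /= /dot.
by rewrite big1 => [|k _]; rewrite ?mul0r // cos0 mulr1 addr0.
Qed.

Lemma trigpolyD G H : trigpoly G -> trigpoly H -> trigpoly (fun x => G x + H x).
Proof.
by move=> [s sE] [r rE]; exists (s ++ r) => x; rewrite big_cat /= sE rE.
Qed.

Lemma trigpoly_sum (I : Type) (s : seq I) (G : I -> (nat -> R) -> R) :
  (forall i, trigpoly (G i)) -> trigpoly (fun x => \sum_(i <- s) G i x).
Proof.
move=> Gt; elim: s => [|i s IH].
  by apply: trigpoly_ext (trigpoly_cst 0) => x; rewrite big_nil.
by apply: trigpoly_ext (trigpolyD (Gt i) IH) => x; rewrite big_cons.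
Qed.

(** Product-to-sum identities: two terms of frequencies [t] and [u] multiply to terms of frequencies
    [t + u] and [t - u]. *)
Lemma trigpolyM G H : trigpoly G -> trigpoly H -> trigpoly (fun x => G x * H x).
Proof.
move=> [s sE] [r rE].
have E x : G x * H x = \sum_(c <- s) \sum_(e <- r)
  ((c.1.1 * cos (dot c.2 x) + c.1.2 * sin (dot c.2 x)) *
   (e.1.1 * cos (dot e.2 x) + e.1.2 * sin (dot e.2 x))).
  by rewrite sE rE mulr_suml; apply: eq_bigr => c _; rewrite mulr_sumr.
apply: (trigpoly_ext E).
apply: trigpoly_sum => -[[a b] t]; apply: trigpoly_sum => -[[c e] u] /=.
exists [:: (((a * c - b * e) / 2, (a * e + b * c) / 2), fun k => t k + u k);
           (((a * c + b * e) / 2, (b * c - a * e) / 2), fun k => t k - u k)] => x.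
rewrite big_cons big_seq1 /= dotD dotB cosD cosB sinD sinB.
by field.
Qed.

Lemma trigpoly_sin (a : R) (k : nat) : (k < m)%N ->
  trigpoly (fun x => sin (a * x k)).
Proof.
move=> km; exists [:: ((0, 1), fun i => if i == k then a else 0)] => x.
rewrite big_seq1 /= mul0r add0r mul1r; congr sin.
rewrite /dot (bigD1 (Ordinal km)) //= eqxx big1 ?addr0 // => i /eqP ik.
by case: eqP => [ik'|_]; rewrite ?mul0r //; case: ik; apply: val_inj.
Qed.

(** * Bernstein averages as expectations of a random walk *)

Section bernstein.
Variable s : nat -> R.

(* Expectation of [h] at the end of a random walk started at [kap], which
   performs, for each index k of the list, a step +e_k with probability s k. *)
Fixpoint walk (ks : seq nat) (h : (nat -> nat) -> R) (kap : nat -> nat) : R :=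
  if ks is k :: ks' then
    s k * walk ks' h (fun i => (kap i + (i == k))%N) + (1 - s k) * walk ks' h kap
  else h kap.

Lemma walkD ks h h' kap :
  walk ks (fun k => h k + h' k) kap = walk ks h kap + walk ks h' kap.
Proof. by elim: ks kap => //= k ks IH kap; rewrite !IH; ring. Qed.

Lemma walkZ ks a h kap : walk ks (fun k => a * h k) kap = a * walk ks h kap.
Proof. by elim: ks kap => //= k ks IH kap; rewrite !IH; ring. Qed.

Lemma walk_cst ks a kap : walk ks (fun=> a) kap = a.
Proof. by elim: ks kap => //= k ks IH kap; rewrite !IH; ring. Qed.

Lemma walk_sum ks (I : Type) (r : seq I) (h : I -> (nat -> nat) -> R) kap :
  walk ks (fun k => \sum_(i <- r) h i k) kap = \sum_(i <- r) walk ks (h i) kap.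
Proof.
elim: r => [|i r IH].
  by rewrite big_nil; under eq_fun do rewrite big_nil; rewrite walk_cst.
by rewrite big_cons; under eq_fun do rewrite big_cons; rewrite walkD IH.
Qed.

Hypothesis s01 : forall k, 0 <= s k <= 1.

Lemma walk_le ks h h' kap : (forall k, h k <= h' k) -> walk ks h kap <= walk ks h' kap.
Proof.
move=> hh; elim: ks kap => //= k ks IH kap; have /andP[s0 s1] := s01 k.
by rewrite lerD // ler_wpM2l // subr_ge0.
Qed.

Lemma walk_dist ks h a g kap : (forall k, `|h k - a| <= g k) ->
  `|walk ks h kap - a| <= walk ks g kap.
Proof.
move=> hg; rewrite ler_norml lerBrDr lerBlDr; apply/andP; split.
  have -> : - walk ks g kap + a = walk ks (fun k => -1 * g k + a) kap.
    by rewrite walkD walkZ walk_cst mulN1r.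
  by apply: walk_le => k; have := hg k; rewrite ler_norml => /andP[]; lra.
rewrite -[in leRHS](walk_cst ks a kap) -walkD.
by apply: walk_le => k; have := hg k; rewrite ler_norml => /andP[]; lra.
Qed.

(** Coordinate [k] of the endpoint is [kap k] plus a binomial variable; the two summands are the
    squared bias and the binomial variance. *)
Lemma walk_var ks k c kap :
  walk ks (fun kap => ((kap k)%:R - c) ^+ 2) kap =
  ((kap k)%:R + (count_mem k ks)%:R * s k - c) ^+ 2
  + (count_mem k ks)%:R * (s k * (1 - s k)).
Proof.
elim: ks kap => [|j ks IH] kap /=; first by rewrite !mul0r !addr0.
rewrite !IH /=; have [->|kj] := eqVneq k j.
  by rewrite !natrD /=; ring.
by rewrite addn0 add0n; ring.
Qed.
End bernstein.

Lemma walk_trigpoly (s : nat -> (nat -> R) -> R) ks h kap :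
  (forall k, k \in ks -> trigpoly (s k)) ->
  trigpoly (fun x => walk (fun k => s k x) ks h kap).
Proof.
elim: ks kap => [|k ks IH] kap st /=; first exact: trigpoly_cst.
have ks_t : forall kap, trigpoly (fun x => walk (fun k => s k x) ks h kap).
  by move=> kp; apply: IH => i iks; apply: st; rewrite inE iks orbT.
have sk : trigpoly (s k) by apply: st; rewrite inE eqxx.
apply: trigpolyD; apply: trigpolyM => //.
apply: trigpoly_ext (trigpolyD (trigpoly_cst 1) (trigpolyM (trigpoly_cst (-1)) sk)).
by move=> x; rewrite mulN1r.
Qed.

End trigonometric_polynomials.

(** * A Lipschitz inverse of the sine on [-1, 1] *)

Section sine_inverse.
Context {R : realType}.

Lemma cos_norm_ge (c : R) : `|c| <= 1 -> cos 1 <= cos c.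
Proof.
move=> c1; rewrite -(cos_norm c) leNgt ltr_cos ?in_itv /= -?leNgt //.
all: by apply/andP; split; have := pi_ge2 R; have := normr_ge0 c; lra.
Qed.

(** Mean value theorem: the derivative of the sine is at least [cos 1] on [-1, 1]. *)
Lemma sin_expand (a b : R) : `|a| <= 1 -> `|b| <= 1 ->
  cos 1 * `|a - b| <= `|sin a - sin b|.
Proof.
wlog : a b / a <= b => [wl ha hb|].
  by have [/wl|/ltW/wl] := leP a b; [exact|rewrite distrC (distrC (sin a)); exact].
rewrite le_eqVlt => /orP[/eqP->|ab]; first by rewrite !subrr normr0 mulr0.
rewrite !ler_norml => /andP[ha _] /andP[_ hb].
have [|c] := @MVT R (@sin R) (@cos R) _ _ ab (fun x _ => is_derive_sin x).
  exact/continuous_subspaceT/continuous_sin.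
rewrite in_itv /= => /andP[ac cb] E.
rewrite distrC (distrC (sin a)) E normrM ler_wpM2r //.
apply: le_trans (ler_norm _); apply: cos_norm_ge.
by rewrite ler_norml; apply/andP; split; lra.
Qed.

(** A left inverse of the sine on [-1, 1], extended to all reals by clamping because the Bernstein
    grid points [2 k / N - 1] may leave [[- sin 1, sin 1]]. *)
Definition clamp_asin (v : R) : R := asin (Num.max (- sin 1) (Num.min (sin 1) v)).

Lemma sin1_bounds : 0 < sin (1 : R) <= 1.
Proof.
by rewrite sin_le1 andbT; apply: sin2_gt0; lra.
Qed.

Lemma clamp_asin_itv v : `|clamp_asin v| <= 1 /\
  sin (clamp_asin v) = Num.max (- sin 1) (Num.min (sin 1) v).
Proof.
have /andP[s0 s1] := sin1_bounds; rewrite /clamp_asin.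
set u := Num.max _ _.
have [ul uh] : - sin 1 <= u /\ u <= sin 1.
  rewrite /u le_max lexx; split => //.
  by rewrite ge_max ge_min lexx /= andbT; lra.
have uin : -1 <= u <= 1 by apply/andP; split; lra.
have su : sin (asin u) = u by apply: asinK; rewrite in_itv.
split => //; have pi2 := pihalf_ge1 R.
have au : asin u \in `[(- (pi / 2)), (pi / 2)].
  by rewrite in_itv /= asin_geNpi2 ?asin_lepi2.
rewrite ler_norml; apply/andP; split; rewrite leNgt -ltr_sin ?su ?sinN -?leNgt //.
  by rewrite in_itv /=; apply/andP; split; lra.
by rewrite in_itv /=; apply/andP; split; lra.
Qed.

(** Clamping to [[- sin 1, sin 1]] fixes [sin a] and does not increase the distance to it;
    [sin_expand] does the rest. *)
Lemma clamp_asin_dist (a v : R) : `|a| <= 1 ->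
  cos 1 * `|clamp_asin v - a| <= `|v - sin a|.
Proof.
move=> a1; have [c1 sc] := clamp_asin_itv v.
apply: (le_trans (sin_expand c1 a1)); rewrite sc.
have [sa sb] : - sin 1 <= sin a /\ sin a <= sin 1.
  have pi2 := pihalf_ge1 R.
  move: a1; rewrite ler_norml => /andP[al ah].
  split; rewrite leNgt -?sinN ltr_sin ?in_itv /= -?leNgt //;
    apply/andP; split; lra.
have /andP[s0 s1] := sin1_bounds.
have [h1|h1] := leP (sin 1) v.
  by rewrite max_r ?ler_norml; [apply/andP; split; have := ler_norm (v - sin a)|]; lra.
have [h2|h2] := leP (- sin 1) v => //.
by rewrite distrC (distrC v) ger0_norm ?ler_norm; [have := ler_norm (sin a - v)|]; lra.
Qed.
End sine_inverse.

(** * Uniform approximation on boxes *)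

Section approximation.
Context {R : realType}.
Variable m : nat.

Definition box (B : R) (x : nat -> R) := forall k, (k < m)%N -> `|x k| <= B.

(** Only the first [m] coordinates are compared, so this also forces [F] to depend on these
    coordinates alone. *)
Definition loc_unif_cont (F : (nat -> R) -> R) := forall B e : R, 0 < e ->
  exists2 dl, 0 < dl & forall x y, box B x -> box B y ->
    (forall k, (k < m)%N -> `|x k - y k| <= dl) -> `|F x - F y| <= e.

(** Bernstein's proof. [G x] averages values of [F] at random grid points, so the bound [M] holds
    everywhere, even off the box. On the box, a grid point within [dl] of [x] costs at most [e / 2]
    by uniform continuity; any other costs at most [2 * M], which Chebyshev's inequality makes small
    on average. *)
Lemma trigpoly_approx (F : (nat -> R) -> R) (M L e : R) :
  (forall x, `|F x| <= M) -> loc_unif_cont F -> 0 < L -> 0 < e ->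
  exists G, [/\ trigpoly m G, forall x, `|G x| <= M &
    forall x, box L x -> `|G x - F x| <= e].
Proof.
move=> FM Fc L0 e0.
have M0 : 0 <= M by apply: le_trans (FM (fun=> 0)).
have e20 : 0 < e / 2 by lra.
have [dl dl0 Fdl] := Fc L _ e20.
have c1 : 0 < cos 1 :> R := cos1_gt0 R.
(* By [clamp_asin_dist], [y kap k - x k] is at most [2 * L / cos 1] times the gap between
   [kap k / N] and [s k x]; [C] is the factor in front of the square of that gap once
   [2 * M * (|y kap k - x k| / dl) ^+ 2] is bounded. *)
pose C := 2 * M * (2 * L / (dl * cos 1)) ^+ 2.
have C0 : 0 <= C by rewrite mulr_ge0 ?sqr_ge0 //; lra.
pose N := (Num.truncn (2 * m%:R * C / e)).+1.
have NC : m%:R * C / N%:R <= e / 2.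
  have := truncnS_gt (2 * m%:R * C / e); rewrite -/N => h.
  rewrite ler_pdivrMr ?ltr0n //.
  by move: h; rewrite ltr_pdivrMr // => h; lra.
have N0 : 0 < N%:R :> R by rewrite ltr0n.
pose s (k : nat) (x : nat -> R) := (1 + sin (L^-1 * x k)) / 2.
pose y (kap : nat -> nat) (k : nat) := L * clamp_asin (2 * (kap k)%:R / N%:R - 1).
(* Each index below [m] occurs [N] times, so the walk ends at independent binomial variables with
   parameters [N] and [s k x]. *)
pose ks := flatten (nseq N (iota 0 m)).
have ksP k : k \in ks -> (k < m)%N.
  move=> /flattenP[l]; rewrite mem_nseq => /andP[_ /eqP ->].
  by rewrite mem_iota.
have count_ks k : (k < m)%N -> count_mem k ks = N.
  move=> km; rewrite /ks count_flatten map_nseq sumn_nseq.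
  by rewrite count_uniq_mem ?iota_uniq // mem_iota /= km mul1n.
have s01 x k : 0 <= s k x <= 1.
  have := sin_le1 (L^-1 * x k); have := sin_geN1 (L^-1 * x k) => ? ?.
  by rewrite /s; apply/andP; split; lra.
exists (fun x => walk (fun k => s k x) ks (fun kap => F (y kap)) (fun=> 0%N)); split.
- apply: walk_trigpoly => k /ksP km.
  apply: (trigpoly_ext (H := fun x => 2^-1 + 2^-1 * sin (L^-1 * x k))).
    by move=> x; rewrite /s; field.
  apply: trigpolyD; first exact: trigpoly_cst.
  by apply: trigpolyM; [exact: trigpoly_cst|exact: trigpoly_sin].
- move=> x; rewrite -[X in `|X|]subr0.
  rewrite -[leRHS](walk_cst (fun k => s k x) ks M (fun=> 0%N)).
  by apply: walk_dist => // kap; rewrite subr0.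
move=> x xL.
pose g (kap : nat -> nat) := e / 2 + \sum_(k <- iota 0 m) C / N%:R ^+ 2 *
   ((kap k)%:R - N%:R * s k x) ^+ 2.
apply: (@le_trans _ _ (walk (fun k => s k x) ks g (fun=> 0%N))).
  apply: walk_dist => // kap; rewrite /g.
  have yL : box L (y kap).
    move=> k _; rewrite /y normrM gtr0_norm //.
    by apply: ler_piMr; [exact: ltW|exact: (proj1 (clamp_asin_itv _))].
  have yx k : (k < m)%N ->
     2 * M * (`|y kap k - x k| / dl) ^+ 2 <= C / N%:R ^+ 2 *
   ((kap k)%:R - N%:R * s k x) ^+ 2.
    move=> km; rewrite /C.
    have xk1 : `|L^-1 * x k| <= 1.
      by rewrite normrM gtr0_norm ?invr_gt0 // mulrC ler_pdivrMr ?mul1r //; exact: xL.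
    have := clamp_asin_dist (2 * (kap k)%:R / N%:R - 1) xk1.
    set z := clamp_asin _ => h.
    have -> : y kap k - x k = L * (z - L^-1 * x k).
      by rewrite /y -/z mulrBr mulrA mulfV ?gt_eqF // mul1r.
    have -> : 2 * M * (2 * L / (dl * cos 1)) ^+ 2 / N%:R ^+ 2 *
        ((kap k)%:R - N%:R * s k x) ^+ 2 =
      2 * M * `|L / (dl * cos 1) * (2 * (kap k)%:R / N%:R - 1 - sin (L^-1 * x k))| ^+ 2.
      rewrite real_normK ?num_real // /s; field.
      by rewrite !gt_eqF.
    apply: ler_wpM2l; first lra.
    rewrite ler_sqr ?nnegrE ?divr_ge0 ?(ltW dl0) //.
    rewrite !normrM (gtr0_norm L0) normfV (gtr0_norm (mulr_gt0 dl0 c1)) invfM.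
    rewrite -!mulrA ler_pM2l // [leLHS]mulrC ler_pM2l ?invr_gt0 //.
    by rewrite ler_pdivlMl // [X in _ <= `|X - 1 - _|]mulrA.
  have [allk|] := pselect (forall k, (k < m)%N -> `|y kap k - x k| <= dl).
    apply: le_trans (Fdl _ _ yL xL allk) _; rewrite lerDl.
    by apply: sumr_ge0 => k _; rewrite mulr_ge0 ?sqr_ge0 // divr_ge0 // sqr_ge0.
  (* For a coordinate farther than [dl], its single term in the sum already exceeds the crude error
     [2 * M]. *)
  move=> /existsNP[k /not_implyP[km /negP]]; rewrite -ltNge => kdl.
  apply: (@le_trans _ _ (2 * M)).
    by apply: le_trans (ler_normB _ _) _; have := FM x; have := FM (y kap); lra.
  apply: ler_wpDl; first lra.
  rewrite (bigD1_seq k) ?iota_uniq ?mem_iota //=.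
  apply: ler_wpDr.
    by apply: sumr_ge0 => i _; rewrite mulr_ge0 ?sqr_ge0 // divr_ge0 // sqr_ge0.
  apply: le_trans (yx _ km); rewrite ler_peMr //; first lra.
  by apply: exprn_ege1; rewrite ler_pdivlMr // mul1r ltW.
rewrite /g walkD walk_cst walk_sum.
rewrite [leRHS](splitr e).
rewrite lerD2l; apply: le_trans NC.
rewrite -[in leRHS](size_iota 0 m) -sum1_size natr_sum mulr_suml mulr_suml.
rewrite !big_seq; apply: ler_sum => k; rewrite mem_iota /= add0n => km.
rewrite walkZ walk_var count_ks // add0r subrr expr0n add0r mul1r.
have /andP[s0 s1] := s01 x k.
have -> : C / N%:R ^+ 2 * (N%:R * (s k x * (1 - s k x))) = C / N%:R * (s k x * (1 - s k x)).
  by field; rewrite gt_eqF.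
by apply: ler_piMr; [rewrite divr_ge0|nra].
Qed.
End approximation.

(** * Convergence of characteristic functions implies convergence in law *)

Section bounded_expectation.
Context {R : realType} d (T : measurableType d) (P : probability T R).

Lemma bounded_Rintegrable (f : T -> R) (M : R) : measurable_fun setT f ->
  (forall w, `|f w| <= M) -> P.-integrable setT (EFin \o f).
Proof.
move=> mf fM; apply: measurable_bounded_integrable => //.
  by rewrite (le_lt_trans (probability_le1 P measurableT)) ?ltry.
exists M; split; first exact: num_real.
by move=> x Mx w _ /=; apply: le_trans (fM w) (ltW Mx).
Qed.

Lemma EFin_Rintegral (f : T -> R) (M : R) : measurable_fun setT f ->
  (forall w, `|f w| <= M) -> (\int[P]_w (f w)%:E)%E = (\int[P]_w f w)%:E.
Proof.
move=> mf fM; rewrite fineK //; apply: integrable_fin_num => //.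
exact: (bounded_Rintegrable mf fM).
Qed.

(** The gap is dominated by [e + 2 * M * \1_A]. The estimate serves for truncation to a box, for
    removing a null set of samples, and for the event where the estimator is not read off the
    cone. *)
Lemma Rintegral_dist_le (f1 f2 : T -> R) (M e : R) (A : set T) :
  measurable_fun setT f1 -> measurable_fun setT f2 -> measurable A ->
  (forall w, `|f1 w| <= M) -> (forall w, `|f2 w| <= M) -> 0 <= e ->
  (forall w, ~ A w -> `|f1 w - f2 w| <= e) ->
  `|\int[P]_w f1 w - \int[P]_w f2 w| <= e + 2 * M * fine (P A).
Proof.
move=> m1 m2 mA b1 b2 e0 h.
have i1 := bounded_Rintegrable m1 b1; have i2 := bounded_Rintegrable m2 b2.
have mB : measurable_fun setT (fun w => f1 w - f2 w) by exact: measurable_funB.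
have bB w : `|f1 w - f2 w| <= 2 * M.
  by apply: le_trans (ler_normB _ _) _; have := b1 w; have := b2 w; lra.
have iB := bounded_Rintegrable mB bB.
rewrite -RintegralB //; apply: le_trans (le_normr_Rintegral _ iB) _ => //.
pose g w := e + 2 * M * (\1_A w : R).
have M0 : 0 <= M.
  (* A space of total mass one has a point, which makes [M] nonnegative. *)
  have [w _] : [set: T] !=set0.
    apply/set0P/eqP => T0; have := @probability_setT _ _ _ P.
    by rewrite T0 measure0 => /eqP; rewrite eqe eq_sym oner_eq0.
  exact: le_trans (b1 w).
have i1A : P.-integrable setT (EFin \o (\1_A : T -> R)).
  apply: (@bounded_Rintegrable _ 1) => // w.
  by rewrite indicE; case: (_ \in _); rewrite ?normr0 ?normr1.
have ig : P.-integrable setT (EFin \o (fun w => 2 * M * (\1_A w : R))).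
  apply: (@bounded_Rintegrable _ (2 * M)).
    exact: measurable_funM.
  move=> w; rewrite indicE; case: (_ \in _); rewrite ?mulr0 ?mulr1 ?normr0.
    by rewrite ger0_norm //; lra.
  lra.
have ie : P.-integrable setT (EFin \o (fun=> e)).
  by apply: (@bounded_Rintegrable _ e) => // w; rewrite ger0_norm.
have -> : e + 2 * M * fine (P A) = \int[P]_w g w.
  have -> : \int[P]_w g w = \int[P]_w e + \int[P]_w (2 * M * (\1_A w : R)).
    by rewrite -RintegralD.
  have -> : \int[P]_w e = e.
    by rewrite Rintegral_cst // -[RHS]mulr1; congr (_ * _); rewrite [X in fine X]probability_setT.
  rewrite RintegralZl //; congr (_ + _ * _).
  by rewrite /Rintegral integral_indic // setIT.
apply: le_Rintegral => //.
- apply: (@bounded_Rintegrable _ (2 * M)); first exact: measurableT_comp.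
  by move=> w; rewrite normr_id.
- apply: (@bounded_Rintegrable _ (e + 2 * M)).
    by apply: measurable_funD => //; apply: measurable_funM.
  move=> w; rewrite /g indicE; case: (_ \in _); rewrite ?mulr0 ?mulr1 ger0_norm; lra.
move=> w _; rewrite /g indicE; case: (boolP (w \in A)) => wA.
  by rewrite mulr1; apply: le_trans (bB w) _; lra.
by rewrite mulr0 addr0; apply: h => /mem_set; rewrite (negbTE wA).
Qed.

Lemma Rintegral_sum (I : Type) (r : seq I) (h : I -> T -> R) :
  (forall i, P.-integrable setT (EFin \o h i)) ->
  \int[P]_w (\sum_(i <- r) h i w) = \sum_(i <- r) \int[P]_w h i w.
Proof.
move=> ih.
suff : P.-integrable setT (EFin \o (fun w => \sum_(i <- r) h i w)) /\
    \int[P]_w (\sum_(i <- r) h i w) = \sum_(i <- r) \int[P]_w h i w by case.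
elim: r => [|i r [IH1 IH2]].
  under eq_fun do rewrite big_nil; split.
    by apply: (@bounded_Rintegrable _ 0) => // w; rewrite normr0.
  by rewrite big_nil Rintegral_cst // mul0r.
under eq_fun do rewrite big_cons; rewrite big_cons; split.
  exact: (integrableD measurableT (ih i) IH1).
by rewrite RintegralD // IH2.
Qed.

End bounded_expectation.

(** * Measurability and tightness of random vectors *)

Section random_vectors.
Context {R : realType} d (T : measurableType d) (m : nat) (Y : nat -> T -> R).
Hypothesis mY : forall k, (k < m)%N -> measurable_fun setT (Y k).

Lemma measurable_dot t : measurable_fun setT (fun w => dot m t (Y^~ w)).
Proof.
apply: measurable_sum => k; apply: measurable_funM => //.
exact: mY.
Qed.

Lemma measurable_cos_dot t : measurable_fun setT (fun w => cos (dot m t (Y^~ w))).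
Proof.
apply: measurableT_comp (measurable_dot t); apply: continuous_measurable_fun.
exact: continuous_cos.
Qed.

Lemma measurable_sin_dot t : measurable_fun setT (fun w => sin (dot m t (Y^~ w))).
Proof.
apply: measurableT_comp (measurable_dot t); apply: continuous_measurable_fun.
exact: continuous_sin.
Qed.

Lemma measurable_trigpoly G : trigpoly m G ->
  measurable_fun setT (fun w => G (Y^~ w)).
Proof.
move=> [s sE]; under eq_fun do rewrite sE.
apply: measurable_sum => c.
apply: measurable_funD; apply: measurable_funM => //.
  exact: measurable_cos_dot.
exact: measurable_sin_dot.
Qed.

(** The function space carries no sigma-algebra here. Instead [F] of the vector is the pointwise
    limit of trigonometric polynomials that are [1 / (n + 1)]-close on the box of radius [n + 1];
    every point eventually lies in these boxes. *)
Lemma measurable_loc_unif_cont F (M : R) : (forall x, `|F x| <= M) ->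
  loc_unif_cont m F -> measurable_fun setT (fun w => F (Y^~ w)).
Proof.
move=> FM Fc.
have H n : exists G, [/\ trigpoly m G, forall x, `|G x| <= M &
    forall x, box m n.+1%:R x -> `|G x - F x| <= n.+1%:R^-1].
  by apply: trigpoly_approx => //; rewrite ?invr_gt0 ltr0n.
have [G HG] := choice H.
apply: (@measurable_fun_cvg _ _ _ _ (fun n w => G n (Y^~ w))).
  by move=> n; apply: measurable_trigpoly; case: (HG n).
move=> w _; apply/cvgrPdist_le => e e0; near=> n.
have [_ _ Gn] := HG n; rewrite distrC.
apply: le_trans (Gn _ _) _.
  move=> k km; apply: (@le_trans _ _ (\sum_(j < m) `|Y j w|)).
    by rewrite (bigD1 (Ordinal km)) //= lerDl sumr_ge0.
  apply: le_trans (ltW (truncnS_gt _)) _; rewrite ler_nat ltnS.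
  by near: n; exact: nbhs_infty_ge.
apply: ltW; near: n; exact: near_infty_natSinv_lt (PosNum e0).
Unshelve. all: by end_near. Qed.

Lemma measurable_not_box (L : R) : measurable [set w | ~ box m L (Y^~ w)].
Proof.
have -> : [set w | ~ box m L (Y^~ w)] =
  ~` \bigcap_(k in `I_m) (Y k @^-1` `[- L, L]).
  apply/seteqP; split => w /= h hb; apply: h => k km.
    by have := hb k km; rewrite /= in_itv /= ler_norml.
  by rewrite /= in_itv /= -ler_norml; exact: hb.
apply: measurableC; apply: fin_bigcap_measurable; first exact: finite_II.
move=> k km.
by rewrite -[_ @^-1` _]setTI; apply: mY => //.
Qed.

(** Continuity from above along the decreasing events of leaving the box of radius [n + 1], whose
    intersection is empty. *)
Lemma tight_vector (Q : probability T R) (e : R) : 0 < e ->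
  exists2 L, 0 < L & fine (Q [set w | ~ box m L (Y^~ w)]) <= e.
Proof.
move=> e0.
pose A (n : nat) := [set w | ~ box m n.+1%:R (Y^~ w)].
have mA n : measurable (A n) by exact: measurable_not_box.
have A0 : \bigcap_n A n = set0.
  apply/seteqP; split => // w /(_ (Num.truncn (\sum_(j < m) `|Y j w|)) I) /=; apply.
  move=> k km; apply: (@le_trans _ _ (\sum_(j < m) `|Y j w|)).
    by rewrite (bigD1 (Ordinal km)) //= lerDl sumr_ge0.
  exact: ltW (truncnS_gt _).
have : (Q \o A) n @[n --> \oo] --> Q (\bigcap_n A n).
  apply: nonincreasing_cvg_mu => //.
  - by rewrite (le_lt_trans (probability_le1 Q (mA 0%N))) ?ltry.
  - by rewrite A0.
  move=> i j ij; apply/subsetPset => w /= h hb; apply: h => k km.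
  by apply: le_trans (hb k km) _; rewrite ler_nat ltnS.
rewrite A0 measure0 => /fine_cvgP[_] /cvgrPdist_le /(_ e e0) [n _ /(_ n)] /=.
rewrite leqnn sub0r normrN => /(_ isT) h; exists n.+1%:R; first by rewrite ltr0n.
by apply: le_trans (ler_norm _) h.
Qed.

End random_vectors.

(** * Lévy's continuity theorem for tight sequences *)

Section levy.
Context {R : realType} d (T : measurableType d) (P : probability T R)
  d' (T' : measurableType d') (Q : probability T' R) (m : nat)
  (Y : nat -> nat -> T -> R) (g : nat -> T' -> R).
Hypothesis mY : forall n k, (k < m)%N -> measurable_fun setT (Y n k).
Hypothesis mg : forall k, (k < m)%N -> measurable_fun setT (g k).
Hypothesis tightY : forall e : R, 0 < e -> exists2 L0, 0 < L0 &
  forall n L, L0 <= L -> fine (P [set w | ~ box m L ((Y n)^~ w)]) <= e.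
Hypothesis cf_cos : forall t, \int[P]_w cos (dot m t ((Y n)^~ w)) @[n --> \oo]
  --> \int[Q]_w cos (dot m t (g^~ w)).
Hypothesis cf_sin : forall t, \int[P]_w sin (dot m t ((Y n)^~ w)) @[n --> \oo]
  --> \int[Q]_w sin (dot m t (g^~ w)).

Lemma Rintegral_trig_sum d1 (T1 : measurableType d1) (P1 : probability T1 R)
    (Z : nat -> T1 -> R) (s : seq (R * R * (nat -> R))) :
  (forall k, (k < m)%N -> measurable_fun setT (Z k)) ->
  \int[P1]_w (\sum_(c <- s) (c.1.1 * cos (dot m c.2 (Z^~ w))
     + c.1.2 * sin (dot m c.2 (Z^~ w)))) =
  \sum_(c <- s) (c.1.1 * \int[P1]_w cos (dot m c.2 (Z^~ w))
     + c.1.2 * \int[P1]_w sin (dot m c.2 (Z^~ w))).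
Proof.
move=> mZ.
have ic t : P1.-integrable setT (EFin \o (fun w => cos (dot m t (Z^~ w)))).
  apply: (@bounded_Rintegrable _ _ _ _ _ 1); first exact: measurable_cos_dot.
  by move=> w; exact: cos_max.
have iS t : P1.-integrable setT (EFin \o (fun w => sin (dot m t (Z^~ w)))).
  apply: (@bounded_Rintegrable _ _ _ _ _ 1); first exact: measurable_sin_dot.
  by move=> w; exact: sin_max.
have iZ (f : T1 -> R) a : P1.-integrable setT (EFin \o f) ->
    P1.-integrable setT (EFin \o (fun w => a * f w)).
  by move=> fi; exact: (integrableZl measurableT a fi).
rewrite Rintegral_sum => [|c].
  by apply: eq_bigr => c _; rewrite RintegralD ?RintegralZl //; apply: (iZ).
exact: (integrableD measurableT (iZ _ _ (ic c.2)) (iZ _ _ (iS c.2))).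
Qed.

(** Replace [F] by a trigonometric polynomial [G] close to it on a box that all the vectors leave
    with probability at most [e1]. Outside the box [G] is still bounded by [M], so a replacement
    costs at most [e1 * (1 + 2 * M)], while the expectations of [G] converge by hypothesis. *)
Lemma levy_continuity (F : (nat -> R) -> R) (M : R) : (forall x, `|F x| <= M) ->
  loc_unif_cont m F ->
  \int[P]_w F ((Y n)^~ w) @[n --> \oo] --> \int[Q]_w F (g^~ w).
Proof.
move=> FM Fc; apply/cvgrPdist_le => e e0.
have M0 : 0 <= M by apply: le_trans (FM (fun=> 0)).
(* Two replacements and the convergence for [G] add up to [2 * e1 * (1 + 2 * M) + e1], which is at
   most [e]. *)
pose e1 := e / (4 * (1 + 2 * M) + 1).
have K0 : 0 < 4 * (1 + 2 * M) + 1 by lra.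
have e10 : 0 < e1 by rewrite divr_gt0.
have [L1 L10 tL1] := tightY e10.
have [L2 L20 tL2] := tight_vector mg Q e10.
pose L := Num.max L1 L2.
have L0 : 0 < L by rewrite lt_max L10.
have [G [Gt GM GF]] := trigpoly_approx FM Fc L0 e10.
have cvgG : \int[P]_w G ((Y n)^~ w) @[n --> \oo] --> \int[Q]_w G (g^~ w).
  have [s sE] := Gt.
  have -> : (fun n => \int[P]_w G ((Y n)^~ w)) =
    (fun n => \sum_(c <- s) (c.1.1 * \int[P]_w cos (dot m c.2 ((Y n)^~ w))
     + c.1.2 * \int[P]_w sin (dot m c.2 ((Y n)^~ w)))).
    apply/funext => n; rewrite -Rintegral_trig_sum //; last exact: mY.
    by apply: eq_Rintegral => w _; rewrite sE.
  rewrite [X in _ --> X](_ : _ = \sum_(c <- s) (c.1.1 * \int[Q]_w cos (dot m c.2 (g^~ w))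
     + c.1.2 * \int[Q]_w sin (dot m c.2 (g^~ w)))); last first.
    rewrite -Rintegral_trig_sum //.
    by apply: eq_Rintegral => w _; rewrite sE.
  apply: cvg_big; first exact: add_continuous.
  move=> c _.
  apply: cvgD; apply: cvgM => //; exact: cvg_cst.
have close d1 (T1 : measurableType d1) (P1 : probability T1 R)
    (Z : nat -> T1 -> R) :
    (forall k, (k < m)%N -> measurable_fun setT (Z k)) ->
    fine (P1 [set w | ~ box m L (Z^~ w)]) <= e1 ->
    `|\int[P1]_w G (Z^~ w) - \int[P1]_w F (Z^~ w)| <= e1 * (1 + 2 * M).
  move=> mZ ZL.
  apply: (@le_trans _ _ (e1 + 2 * M * fine (P1 [set w | ~ box m L (Z^~ w)]))).
    apply: Rintegral_dist_le => //.
    - exact: (measurable_trigpoly mZ Gt).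
    - exact: (measurable_loc_unif_cont mZ FM).
    - exact: measurable_not_box.
    - exact: ltW.
    - by move=> w /contrapT wL; exact: GF.
  by rewrite mulrDr mulr1 lerD2l mulrC ler_wpM2r //; lra.
have closeg : `|\int[Q]_w G (g^~ w) - \int[Q]_w F (g^~ w)| <= e1 * (1 + 2 * M).
  apply: close => //; apply: le_trans tL2; rewrite fine_le //.
  - by apply: fin_num_measure; apply: measurable_not_box.
  - by apply: fin_num_measure; apply: measurable_not_box.
  apply: le_measure; rewrite ?inE; [exact: measurable_not_box|exact: measurable_not_box|].
  move=> w /= h hb; apply: h => k km; apply: le_trans (hb k km) _.
  by rewrite le_max lexx orbT.
move/cvgrPdist_le : cvgG => /(_ e1 e10); apply: filterS => n hn.
have closeY : `|\int[P]_w G ((Y n)^~ w) - \int[P]_w F ((Y n)^~ w)| <= e1 * (1 + 2 * M).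
  by apply: close; [exact: mY|apply: tL1; rewrite le_max lexx].
have eE : e = 2 * (e1 * (1 + 2 * M)) + e1 + e1 * (2 * (1 + 2 * M)).
  by rewrite /e1; field; rewrite gt_eqF.
have eM : 0 <= e1 * (2 * (1 + 2 * M)) by rewrite mulr_ge0 // ?(ltW e10) //; lra.
move: closeg closeY hn; rewrite !ler_norml => /andP[? ?] /andP[? ?] /andP[? ?].
by apply/andP; split; lra.
Qed.

End levy.

(** * The multinomial central limit theorem *)

Section taylor_bounds.
Context {R : realType}.

(** Mean value theorem between 0 and [x]. Iterated along sine and cosine it gives remainders of the
    right order, without the sharp factorial constants. *)
Lemma norm_le_of_derive (f df : R -> R) (n : nat) :
  (forall x : R, is_derive x (1 : R) f (df x)) -> f 0 = 0 ->
  (forall x, `|df x| <= `|x| ^+ n) -> forall x, `|f x| <= `|x| ^+ n.+1.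
Proof.
move=> fd f0 dfn x.
have fc (a b : R) : {within `[a, b], continuous f}.
  apply/continuous_subspaceT => z; apply: differentiable_continuous.
  by apply/derivable1_diffP; exact: (@ex_derive _ _ _ _ _ _ _ (fd z)).
have [x0|x0|<-] := ltgtP 0 x; last by rewrite f0 !normr0 expr0n.
- have [c] := MVT x0 (fun x _ => fd x) (fc _ _).
  rewrite in_itv /= => /andP[c0 cx]; rewrite f0 !subr0 => ->.
  rewrite normrM exprSr ler_wpM2r //; apply: le_trans (dfn c) _.
  by rewrite lerXn2r ?nnegrE // !gtr0_norm // ltW.
have [c] := MVT x0 (fun x _ => fd x) (fc _ _).
rewrite in_itv /= => /andP[c0 cx]; rewrite f0 !sub0r -[`|f x|]normrN => ->.
rewrite normrM exprSr normrN ler_wpM2r //; apply: le_trans (dfn c) _.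
by rewrite lerXn2r ?nnegrE // !ltr0_norm // lerN2 ltW.
Qed.

Lemma norm_sin_le (x : R) : `|sin x| <= `|x|.
Proof.
rewrite -[leRHS]expr1; apply: (@norm_le_of_derive _ (@cos R)) => [|y].
  exact: sin0.
by rewrite expr0; exact: cos_max.
Qed.

Lemma norm_cosB1_le (x : R) : `|cos x - 1| <= `|x| ^+ 2.
Proof.
apply: (@norm_le_of_derive (fun x => cos x - 1) (fun x => - sin x)) => [y||y].
- by apply: is_derive_eq; rewrite subr0.
- by rewrite cos0 subrr.
by rewrite normrN expr1 norm_sin_le.
Qed.

Lemma norm_sinB_le (x : R) : `|sin x - x| <= `|x| ^+ 3.
Proof.
by apply: (@norm_le_of_derive (fun x => sin x - x) (fun x => cos x - 1)) => [|y];
  rewrite ?sin0 ?subrr ?norm_cosB1_le.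
Qed.

Lemma norm_cos_taylor2 (x : R) : `|cos x - 1 + x ^+ 2 / 2| <= `|x| ^+ 4.
Proof.
apply: (@norm_le_of_derive (fun x => cos x - 1 + x ^+ 2 / 2) (fun x => x - sin x)) => [y||y].
- by apply: is_derive_eq; rewrite /GRing.scale /=; field.
- by rewrite cos0 subrr expr0n mul0r addr0.
by rewrite distrC norm_sinB_le.
Qed.

(** The exponential lies above its tangent at 0, both at [- y] and at [y]; the latter bounds
    [expR (- y)] by [1 / (1 + y)], and [(1 - y + y ^+ 2) * (1 + y) = 1 + y ^+ 3] is at least 1. *)
Lemma norm_expRN_taylor1 (y : R) : 0 <= y -> `|1 - y - expR (- y)| <= y ^+ 2.
Proof.
move=> y0; have h1 := expR_ge1Dx (- y); rewrite distrC ger0_norm; last lra.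
rewrite lerBlDr expRN -[leLHS]mul1r ler_pdivrMr ?expR_gt0 //.
apply: (@le_trans _ _ ((y ^+ 2 + (1 - y)) * (1 + y))).
  have -> : (y ^+ 2 + (1 - y)) * (1 + y) = 1 + y ^+ 3 by ring.
  by rewrite lerDl exprn_ge0.
by rewrite ler_wpM2l ?expR_ge1Dx //; nra.
Qed.

End taylor_bounds.

(** * Expectations over finite sequences of independent draws *)

Section sequences_of_outcomes.
Context {R : realType}.
Variables (p : nat -> R) (S : nat).

Fixpoint outcomes (n : nat) : seq (seq nat) :=
  if n is n'.+1 then [seq j :: s | j <- iota 0 S.+1, s <- outcomes n'] else [:: [::]].

Lemma outcomesS n :
  outcomes n.+1 = [seq j :: s | j <- iota 0 S.+1, s <- outcomes n].
Proof. by []. Qed.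

Lemma outcomes_uniq n : uniq (outcomes n).
Proof.
elim: n => // n IH; rewrite outcomesS; apply: allpairs_uniq => //.
  exact: iota_uniq.
by move=> [j s] [j' s'] _ _ [-> ->].
Qed.

Lemma mem_outcomes n s : (s \in outcomes n) = (size s == n) && all (fun j => j <= S)%N s.
Proof.
elim: n s => [|n IH] s; first by rewrite /= inE; case: s.
rewrite outcomesS; apply/allpairsP/idP => [[[j s'] [jS]]|].
  by rewrite IH => /andP[/eqP <- h] ->; rewrite /= eqxx h andbT; move: jS; rewrite mem_iota.
case: s => // j s; rewrite [size _]/= eqSS [all _ _]/= => /and3P[sn jS sS].
by exists (j, s); split; rewrite ?mem_iota ?IH ?sn.
Qed.

(** The expectation of [h] over [n] independent draws from [p], as a finite sum: independence
    becomes the recursion [pexpS] on [n]. *)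
Definition pexp (n : nat) (h : seq nat -> R) : R :=
  \sum_(s <- outcomes n) (\prod_(j <- s) p j) * h s.

Lemma pexp0 h : pexp 0 h = h [::].
Proof. by rewrite /pexp big_seq1 big_nil mul1r. Qed.

Lemma pexpS n h : pexp n.+1 h = \sum_(j < S.+1) p j * pexp n (fun s => h ((j : nat) :: s)).
Proof.
rewrite /pexp outcomesS big_allpairs_dep.
rewrite -[X in iota 0 X]subn0 -/(index_iota 0 S.+1) big_mkord.
apply: eq_bigr => j _; rewrite mulr_sumr; apply: eq_bigr => s _.
by rewrite big_cons mulrA.
Qed.

Lemma eq_pexp n h1 h2 : (forall s, size s = n -> h1 s = h2 s) ->
  pexp n h1 = pexp n h2.
Proof.
move=> hh; rewrite /pexp !big_seq; apply: eq_bigr => s.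
by rewrite mem_outcomes => /andP[/eqP/hh -> _].
Qed.

Lemma pexpD n h1 h2 : pexp n (fun s => h1 s + h2 s) = pexp n h1 + pexp n h2.
Proof. by rewrite -big_split; apply: eq_bigr => s _; rewrite mulrDr. Qed.

Lemma pexpZ n a h : pexp n (fun s => a * h s) = a * pexp n h.
Proof. by rewrite /pexp mulr_sumr; apply: eq_bigr => s _; rewrite mulrCA. Qed.

Lemma pexp_sum n (I : Type) (r : seq I) (h : I -> seq nat -> R) :
  pexp n (fun s => \sum_(i <- r) h i s) = \sum_(i <- r) pexp n (h i).
Proof.
by rewrite /pexp exchange_big; apply: eq_bigr => s _; rewrite mulr_sumr.
Qed.

Hypothesis p0 : forall j, 0 <= p j.
Hypothesis p1 : \sum_(j < S.+1) p j = 1.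

Lemma ler_pexp n h1 h2 : (forall s, s \in outcomes n -> h1 s <= h2 s) ->
  pexp n h1 <= pexp n h2.
Proof.
move=> hh; rewrite /pexp !big_seq; apply: ler_sum => s.
by move=> /hh h12; apply: ler_wpM2l => //; exact: prodr_ge0.
Qed.

Lemma pexp_cst n a : pexp n (fun=> a) = a.
Proof.
elim: n => [|n IH]; first by rewrite pexp0.
by rewrite pexpS; under eq_bigr do rewrite IH; rewrite -mulr_suml p1 mul1r.
Qed.

(** Splitting off the first draw, the cross term vanishes because the remaining sum has mean zero
    ([E1]). *)
Lemma pexp_var n (v : nat -> R) : \sum_(j < S.+1) p j * v j = 0 ->
  pexp n (fun s => (\sum_(j <- s) v j) ^+ 2) = n%:R * \sum_(j < S.+1) p j * v j ^+ 2.
Proof.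
move=> v0.
have E1 k : pexp k (fun s => \sum_(j <- s) v j) = 0.
  elim: k => [|k IH]; first by rewrite pexp0 big_nil.
  rewrite pexpS -[RHS]v0; apply: eq_bigr => j _.
  under eq_fun do rewrite big_cons.
  by rewrite pexpD pexp_cst IH addr0.
elim: n => [|n IH]; first by rewrite pexp0 big_nil expr0n mul0r.
rewrite pexpS.
have -> : \sum_(j < S.+1) p j * pexp n (fun s => (\sum_(i <- (j : nat) :: s) v i) ^+ 2)
  = \sum_(j < S.+1) (p j * v j ^+ 2 + p j * pexp n (fun s => (\sum_(i <- s) v i) ^+ 2)).
  apply: eq_bigr => j _; rewrite -mulrDr; congr (_ * _).
  rewrite (@eq_pexp n _ (fun s => v j ^+ 2 + (2 * v j * (\sum_(i <- s) v i) +
    (\sum_(i <- s) v i) ^+ 2))); last first.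
    by move=> s _; rewrite big_cons; ring.
  by rewrite !pexpD pexp_cst pexpZ E1 mulr0 add0r.
rewrite big_split /= IH -mulr_suml p1 mul1r -natr1; ring.
Qed.

(** The two expectations are the real and imaginary parts of the [n]-th power of [a + i b]; [cS] and
    [eS] are multiplication by [a + i b]. Since all quantities are bounded by 1, each factor adds at
    most [|a - r| + |b|] to the distance from [r ^+ n]. *)
Lemma pexp_trig n (u : nat -> R) (r : R) : 0 <= r <= 1 ->
  let a := \sum_(j < S.+1) p j * cos (u j) in
  let b := \sum_(j < S.+1) p j * sin (u j) in
  `|pexp n (fun s => cos (\sum_(j <- s) u j)) - r ^+ n| <= n%:R * (`|a - r| + `|b|) /\
  `|pexp n (fun s => sin (\sum_(j <- s) u j))| <= n%:R * `|b|.
Proof.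
move=> /andP[r0 r1] a b.
pose c n := pexp n (fun s => cos (\sum_(j <- s) u j)).
pose e n := pexp n (fun s => sin (\sum_(j <- s) u j)).
have cS k : c k.+1 = a * c k - b * e k.
  rewrite /c pexpS /a /b !mulr_suml -sumrB; apply: eq_bigr => j _.
  rewrite -!mulrA -mulrBr; congr (_ * _).
  rewrite -!pexpZ -mulN1r -pexpZ -pexpD; apply: eq_pexp => s _.
  by rewrite big_cons cosD mulN1r.
have eS k : e k.+1 = a * e k + b * c k.
  rewrite /e pexpS /a /b !mulr_suml -big_split /=; apply: eq_bigr => j _.
  rewrite -!mulrA -mulrDr; congr (_ * _).
  rewrite -!pexpZ -pexpD; apply: eq_pexp => s _.
  by rewrite big_cons sinD addrC.
have bound (h : seq nat -> R) k : (forall s, `|h s| <= 1) -> `|pexp k h| <= 1.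
  move=> h1; rewrite ler_norml -{1}(pexp_cst k (-1)) -{2}(pexp_cst k 1).
  by apply/andP; split; apply: ler_pexp => s _; have := h1 s; rewrite ler_norml => /andP[].
have c1 k : `|c k| <= 1 by apply: bound => s; exact: cos_max.
have e1 k : `|e k| <= 1 by apply: bound => s; exact: sin_max.
have a1 : `|a| <= 1.
  by have := c1 1%N; rewrite cS /c /e !pexp0 big_nil cos0 sin0 mulr1 mulr0 subr0.
rewrite -/(c n) -/(e n); elim: n => [|n [IH1 IH2]].
  by rewrite /c /e !pexp0 big_nil cos0 sin0 expr0 subrr normr0 !mul0r.
rewrite cS eS -natr1 mulrDl mul1r (mulrDl n%:R) mul1r; split.
  have -> : a * c n - b * e n - r ^+ n.+1 = a * (c n - r ^+ n) + ((a - r) * r ^+ n - b * e n).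
    by rewrite exprS; ring.
  apply: le_trans (ler_normD _ _) _; apply: lerD.
    by apply: le_trans IH1; rewrite normrM ler_piMl.
  apply: le_trans (ler_normB _ _) _; apply: lerD; rewrite normrM ler_piMr //.
  by rewrite ger0_norm ?exprn_ge0 // exprn_ile1.
apply: le_trans (ler_normD _ _) _; apply: lerD.
  by apply: le_trans IH2; rewrite normrM ler_piMl.
by rewrite normrM ler_piMr.
Qed.

(** With [d n] the inverse of the square root of [n], Taylor expansion gives [b] of order
    [d n ^+ 3], as [v] is centered, and [a - r] of order [d n ^+ 4]. The factor [n] in [pexp_trig]
    cancels [d n ^+ 2], leaving an error of at most [K * d n]. *)
Lemma cvg_cf (v : nat -> R) : \sum_(j < S.+1) p j * v j = 0 ->
  let q := \sum_(j < S.+1) p j * v j ^+ 2 in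
  pexp n (fun s => cos (\sum_(j <- s) (Num.sqrt n%:R)^-1 * v j)) @[n --> \oo]
    --> expR (- q / 2) /\
  pexp n (fun s => sin (\sum_(j <- s) (Num.sqrt n%:R)^-1 * v j)) @[n --> \oo] --> (0 : R).
Proof.
move=> v0 q.
pose K3 := \sum_(j < S.+1) p j * `|v j| ^+ 3.
pose K4 := \sum_(j < S.+1) p j * `|v j| ^+ 4.
have q0 : 0 <= q by apply: sumr_ge0 => j _; rewrite mulr_ge0 ?sqr_ge0.
have K30 : 0 <= K3 by apply: sumr_ge0 => j _; rewrite mulr_ge0 ?exprn_ge0.
have K40 : 0 <= K4 by apply: sumr_ge0 => j _; rewrite mulr_ge0 ?exprn_ge0.
pose K := K3 + K4 + q ^+ 2 / 4.
pose d (n : nat) : R := (Num.sqrt n%:R)^-1.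
have main n : (0 < n)%N ->
   `|pexp n (fun s => cos (\sum_(j <- s) d n * v j)) - expR (- q / 2)| <= K * d n /\
   `|pexp n (fun s => sin (\sum_(j <- s) d n * v j))| <= K * d n.
  move=> n0; have n0' : 0 < n%:R :> R by rewrite ltr0n.
  have d0 : 0 < d n by rewrite invr_gt0 sqrtr_gt0.
  have dn : n%:R * d n ^+ 2 = 1.
    by rewrite exprVn sqr_sqrtr ?ler0n // mulfV // gt_eqF.
  have d1 : d n <= 1.
    rewrite -(ler_sqr (x := d n)) ?nnegrE ?ler01 ?(ltW d0) // expr1n -dn ler_peMl ?sqr_ge0 //.
    by rewrite ler1n.
  have y0 : 0 <= q * d n ^+ 2 / 2 by rewrite divr_ge0 // mulr_ge0 // sqr_ge0.
  (* The number [r] is chosen so that its [n]-th power is exactly [expR (- q / 2)]. *)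
  have r01 : 0 <= expR (- (q * d n ^+ 2 / 2)) <= 1.
    by rewrite expR_ge0 /= expR_le1 oppr_le0.
  have := pexp_trig n (fun j => d n * v j) r01.
  rewrite -expRM_natl.
  have -> : n%:R * - (q * d n ^+ 2 / 2) = - q / 2.
    have -> : n%:R * - (q * d n ^+ 2 / 2) = - (q * (n%:R * d n ^+ 2)) / 2 by field.
    by rewrite dn mulr1.
  set a := (\sum_(j < S.+1) p j * cos (d n * v j)).
  set b := (\sum_(j < S.+1) p j * sin (d n * v j)).
  set r := expR (- (q * _ / 2)).
  have bb : `|b| <= d n ^+ 3 * K3.
    have -> : b = \sum_(j < S.+1) p j * (sin (d n * v j) - d n * v j).
      under [RHS]eq_bigr do rewrite mulrBr.
      rewrite sumrB; under [X in _ = _ - X]eq_bigr do rewrite mulrCA.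
      by rewrite -mulr_sumr v0 mulr0 subr0.
    apply: le_trans (ler_norm_sum _ _ _) _; rewrite mulr_sumr; apply: ler_sum => j _.
    rewrite normrM ger0_norm // mulrCA ler_wpM2l //.
    by apply: le_trans (norm_sinB_le _) _; rewrite normrM exprMn (gtr0_norm d0).
  have aa : `|a - r| <= d n ^+ 4 * K4 + d n ^+ 4 * (q ^+ 2 / 4).
    have -> : a - r = \sum_(j < S.+1) p j * (cos (d n * v j) - 1 + (d n * v j) ^+ 2 / 2)
        + (1 - q * d n ^+ 2 / 2 - r).
      have -> : \sum_(j < S.+1) p j * (cos (d n * v j) - 1 + (d n * v j) ^+ 2 / 2)
         = a - 1 + d n ^+ 2 / 2 * q.
        rewrite -[X in a - X]p1 /q mulr_sumr -sumrB -big_split /=.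
        by apply: eq_bigr => j _; field.
      by field.
    apply: le_trans (ler_normD _ _) _; apply: lerD; last first.
      apply: le_trans (norm_expRN_taylor1 y0) _.
      have -> // : (q * d n ^+ 2 / 2) ^+ 2 = d n ^+ 4 * (q ^+ 2 / 4) by field.
    apply: le_trans (ler_norm_sum _ _ _) _; rewrite mulr_sumr; apply: ler_sum => j _.
    rewrite normrM ger0_norm // mulrCA ler_wpM2l //.
    by apply: le_trans (norm_cos_taylor2 _) _; rewrite normrM exprMn (gtr0_norm d0).
  have nb : n%:R * `|b| <= d n * K3.
    apply: (@le_trans _ _ (n%:R * (d n ^+ 3 * K3))); first by rewrite ler_pM2l.
    have -> : n%:R * (d n ^+ 3 * K3) = (n%:R * d n ^+ 2) * (d n * K3) by ring.
    by rewrite dn mul1r.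
  have na : n%:R * `|a - r| <= d n * (K4 + q ^+ 2 / 4).
    apply: (@le_trans _ _ (n%:R * (d n ^+ 4 * K4 + d n ^+ 4 * (q ^+ 2 / 4)))).
      by rewrite ler_pM2l.
    have -> : n%:R * (d n ^+ 4 * K4 + d n ^+ 4 * (q ^+ 2 / 4)) =
      (n%:R * d n ^+ 2) * (d n * (d n * (K4 + q ^+ 2 / 4))) by ring.
    by rewrite dn mul1r ler_pM2l // ler_piMl // addr_ge0 // divr_ge0 // sqr_ge0.
  have dK : 0 <= d n * (K4 + q ^+ 2 / 4).
    by rewrite mulr_ge0 ?(ltW d0) // addr_ge0 // divr_ge0 // sqr_ge0.
  move=> [h1 h2]; split.
    by apply: le_trans h1 _; rewrite mulrDr /K mulrC; lra.
  by apply: le_trans h2 _; rewrite /K; lra.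
have d_cvg : d n @[n --> \oo] --> (0 : R).
  apply/cvgrPdist_le => e e0; near=> n.
  have n0 : (0 < n)%N by near: n; exact: nbhs_infty_gt.
  rewrite sub0r normrN ger0_norm ?invr_ge0 ?sqrtr_ge0 //.
  rewrite /d -[leRHS]invrK lef_pV2 ?posrE ?invr_gt0 ?sqrtr_gt0 ?ltr0n //.
  rewrite -[leLHS]ger0_norm ?invr_ge0 ?(ltW e0) // -sqrtr_sqr ler_sqrt ?ler0n //.
  apply: ltW; near: n; exact: nbhs_infty_gtr.
have Kd_cvg : K * d n @[n --> \oo] --> (0 : R).
  by rewrite -[X in _ --> X](mulr0 K); apply: cvgM => //; exact: cvg_cst.
split.
  apply/cvgrPdist_le => e e0; move/cvgrPdist_le : Kd_cvg => /(_ e e0) H; near=> n.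
  have n0 : (0 < n)%N by near: n; exact: nbhs_infty_gt.
  rewrite distrC; apply: le_trans (proj1 (main n n0)) _.
  apply: le_trans (ler_norm _) _; rewrite -normrN -sub0r; near: n; exact: H.
apply/cvgrPdist_le => e e0; move/cvgrPdist_le : Kd_cvg => /(_ e e0) H; near=> n.
have n0 : (0 < n)%N by near: n; exact: nbhs_infty_gt.
rewrite distrC subr0; apply: le_trans (proj2 (main n n0)) _.
apply: le_trans (ler_norm _) _; rewrite -normrN -sub0r; near: n; exact: H.
Unshelve. all: by end_near. Qed.

End sequences_of_outcomes.

(** * The law of the sample and its rescaled fluctuations *)

Section sample.
Context {R : realType} d (T : measurableType d) (P : probability T R).
Variables (X : nat -> T -> nat) (p : nat -> R) (S : nat).
Hypothesis iid : iid_pmf P X p.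
Hypothesis p0 : forall j, 0 <= p j.
Hypothesis p1 : \sum_(j < S.+1) p j = 1.

Definition sample (n : nat) (w : T) : seq nat := mkseq (X^~ w) n.

Lemma sample_eqP n (s : seq nat) : size s = n ->
  [set w | sample n w = s] = [set w | forall i, (i < n)%N -> X i w = nth 0%N s i].
Proof.
move=> sn; apply/seteqP; split => w /=.
  by move=> <- i iN; rewrite nth_mkseq.
move=> h; apply: (@eq_from_nth _ 0%N); first by rewrite size_mkseq sn.
by move=> i; rewrite size_mkseq => iN; rewrite nth_mkseq // h.
Qed.

Lemma measurable_sample_eq n (s : seq nat) : measurable [set w | sample n w = s].
Proof.
have [sn|sn] := eqVneq (size s) n; last first.
  rewrite (_ : [set w | _] = set0) //; apply/seteqP; split => // w /= h.
  by move: sn; rewrite -h size_mkseq eqxx.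
rewrite sample_eqP //.
have -> : [set w | forall i, (i < n)%N -> X i w = nth 0%N s i] =
  \bigcap_(i in `I_n) [set w | X i w = nth 0%N s i] by [].
apply: fin_bigcap_measurable; first exact: finite_II.
by move=> i _; case: iid.
Qed.

(** Finite sequences of naturals are countable, so the event is a countable union of events fixing
    the sample. Hence every function of the sample is measurable. *)
Lemma measurable_sample n (B : set (seq nat)) : measurable [set w | B (sample n w)].
Proof.
have -> : [set w | B (sample n w)] =
  \bigcup_(k in [set k | exists2 s, unpickle k = Some s & B s])
     [set w | sample n w = odflt [::] (unpickle k)].
  apply/seteqP; split => w.
    move=> Bw; exists (pickle (sample n w)); last by rewrite /mkset pickleK.
    by exists (sample n w) => //; exact: pickleK.
  by move=> [k [s ks Bs]]; rewrite /mkset ks /= => ->.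
by apply: bigcup_measurable => k _; exact: measurable_sample_eq.
Qed.

Lemma measurable_fun_sample n (h : seq nat -> R) :
  measurable_fun setT (fun w => h (sample n w)).
Proof.
move=> _ Y mY; rewrite setTI.
exact: (measurable_sample n (fun s => Y (h s))).
Qed.

Lemma prob_sample n s : size s = n ->
  P [set w | sample n w = s] = (\prod_(j <- s) p j)%:E.
Proof.
move=> sn; rewrite sample_eqP // (proj2 iid n (nth 0%N s)); congr EFin.
by rewrite (big_nth 0%N) big_mkord sn.
Qed.

Lemma Rintegral_indic_sum (I : eqType) (r : seq I) (a : I -> R) (A : I -> set T) :
  (forall i, measurable (A i)) ->
  \int[P]_w (\sum_(i <- r) a i * \1_(A i) w) = \sum_(i <- r) a i * fine (P (A i)).
Proof.
move=> mA.
have ind1 i w : `|\1_(A i) w : R| <= 1.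
  by rewrite indicE; case: (_ \in _); rewrite ?normr0 ?normr1.
have i1 i : P.-integrable setT (EFin \o (fun w => \1_(A i) w : R)).
  by apply: (@bounded_Rintegrable _ _ _ _ _ 1); [exact: measurable_indic|exact: ind1].
have i2 i : P.-integrable setT (EFin \o (fun w => a i * \1_(A i) w)).
  exact: (integrableZl measurableT (a i) (i1 i)).
rewrite Rintegral_sum //; apply: eq_bigr => i _; rewrite RintegralZl //.
by rewrite /Rintegral integral_indic // setIT.
Qed.

Lemma sum_outcomes_indic n (h : seq nat -> R) w :
  \sum_(s <- outcomes S n) h s * \1_[set w | sample n w = s] w =
  if sample n w \in outcomes S n then h (sample n w) else 0.
Proof.
case: ifPn => hs.
  rewrite (bigD1_seq _ hs (outcomes_uniq _ _)) /= indicE mem_set // mulr1.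
  rewrite big1 ?addr0 // => s sw; rewrite indicE memNset ?mulr0 //= => e.
  by rewrite e eqxx in sw.
rewrite big_seq big1 // => s sn; rewrite indicE memNset ?mulr0 //= => e.
by rewrite e sn in hs.
Qed.

Lemma Rintegral_outcomes n (h : seq nat -> R) :
  \int[P]_w (if sample n w \in outcomes S n then h (sample n w) else 0) = pexp p S n h.
Proof.
have -> : \int[P]_w (if sample n w \in outcomes S n then h (sample n w) else 0) =
   \int[P]_w (\sum_(s <- outcomes S n) h s * \1_[set w | sample n w = s] w).
  by apply: eq_Rintegral => w _; rewrite sum_outcomes_indic.
rewrite Rintegral_indic_sum; last by move=> s; exact: measurable_sample_eq.
rewrite /pexp !big_seq; apply: eq_bigr => s; rewrite mem_outcomes => /andP[/eqP sn _].
by rewrite prob_sample // mulrC.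
Qed.

(** Observations are at most [S] only almost surely: the sequences in [outcomes] already carry total
    mass [pexp] of 1, which is 1. *)
Lemma prob_not_outcomes n : fine (P [set w | sample n w \notin outcomes S n]) = 0.
Proof.
have mA := measurable_sample n (fun s => s \in outcomes S n).
have := Rintegral_outcomes n (fun=> 1); rewrite pexp_cst //.
have -> : \int[P]_w (if sample n w \in outcomes S n then 1 else 0) =
   \int[P]_w (\1_[set w | sample n w \in outcomes S n] w : R).
  apply: eq_Rintegral => w _; rewrite indicE.
  by case: ifPn => h; [rewrite mem_set|rewrite memNset //; exact/negP].
rewrite /Rintegral integral_indic // setIT => PA.
have -> : [set w | sample n w \notin outcomes S n] = ~` [set w | sample n w \in outcomes S n].
  by apply/seteqP; split => w /= h; exact/negP.
rewrite probability_setC // fineB //; last exact: fin_num_measure.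
by rewrite PA subrr.
Qed.

Lemma Rintegral_sample n (h : seq nat -> R) (M : R) : (forall s, `|h s| <= M) ->
  \int[P]_w h (sample n w) = pexp p S n h.
Proof.
move=> hM; rewrite -Rintegral_outcomes; apply/eqP; rewrite -subr_eq0 -normr_le0.
apply: (@le_trans _ _ (0 + 2 * M * fine (P [set w | sample n w \notin outcomes S n])));
  last by rewrite prob_not_outcomes mulr0 addr0.
apply: Rintegral_dist_le => //.
- exact: measurable_fun_sample.
- exact: (measurable_fun_sample n (fun s => if s \in outcomes S n then h s else 0)).
- exact: (measurable_sample n (fun s => s \notin outcomes S n)).
- by move=> w; case: ifP => // _; rewrite normr0; exact: le_trans (hM [::]).
- by move=> w /= /negP; rewrite negbK => ->; rewrite subrr normr0.
Qed.

(** Markov's inequality: [h] dominates the indicator of [B] on the possible outcomes. *)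
Lemma prob_sample_le n (B : set (seq nat)) (h : seq nat -> R) :
  (forall s, 0 <= h s) -> (forall s, s \in outcomes S n -> B s -> 1 <= h s) ->
  fine (P [set w | B (sample n w)]) <= pexp p S n h.
Proof.
move=> h0 h1.
have -> : fine (P [set w | B (sample n w)]) = \int[P]_w (\1_B (sample n w) : R).
  have -> : \int[P]_w (\1_B (sample n w) : R) = \int[P]_w (\1_[set w | B (sample n w)] w : R).
    apply: eq_Rintegral => w _; rewrite !indicE.
    by congr (_ : bool)%:R; apply/idP/idP => /set_mem h; apply/mem_set.
  by rewrite /Rintegral integral_indic ?setIT //; exact: measurable_sample.
rewrite (@Rintegral_sample n _ 1); last first.
  by move=> s; rewrite indicE; case: (_ \in _); rewrite ?normr0 ?normr1.
apply: ler_pexp => // s sn; rewrite indicE; case: (boolP (s \in B)) => [/set_mem|_].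
  exact: h1.
exact: h0.
Qed.

(* The rescaled fluctuation vector sqrt n (p_n - p), read off the sample. *)
Definition fluct (n k : nat) (s : seq nat) : R :=
  Num.sqrt n%:R * (n%:R^-1 * \sum_(j <- s) ((j == k) : nat)%:R - p k).

Lemma empirical_sample n w k : empirical_pmf (R := R) X n w k =
  n%:R^-1 * \sum_(j <- sample n w) ((j == k) : nat)%:R.
Proof.
by rewrite /empirical_pmf /sample big_map -[X in iota 0 X]subn0 -/(index_iota 0 n) big_mkord.
Qed.

Lemma fluctE n k s : size s = n ->
  fluct n k s = \sum_(j <- s) (Num.sqrt n%:R)^-1 * (((j == k) : nat)%:R - p k).
Proof.
move=> sn; rewrite /fluct -mulr_sumr sumrB big_const_seq count_predT sn iter_addr_0.
(* For [n = 0] both sides vanish, the inverse of 0 being 0. *)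
have [->|n0] := eqVneq n 0%N; first by rewrite sqrtr0 invr0 !mul0r.
have n0' : 0 < n%:R :> R by rewrite ltr0n lt0n.
have q : Num.sqrt n%:R ^+ 2 = n%:R :> R by rewrite sqr_sqrtr // ltW.
have q0 : Num.sqrt n%:R != 0 :> R by rewrite gt_eqF // sqrtr_gt0.
rewrite -(mulr_natr (p k) n); move: (Num.sqrt n%:R) q q0 => r q q0.
by rewrite -q; field.
Qed.

Lemma sum_centered k : (k <= S.+1)%N -> p S.+1 = 0 ->
  \sum_(j < S.+1) p j * (((j == k :> nat) : nat)%:R - p k) = 0.
Proof.
move=> kS pS.
under eq_bigr do rewrite mulrBr.
rewrite sumrB -mulr_suml p1 mul1r; apply/eqP; rewrite subr_eq0; apply/eqP.
have [k1|k1] := ltnP k S.+1.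
  rewrite (bigD1 (Ordinal k1)) //= eqxx mulr1 big1 ?addr0 // => j jk.
  by rewrite (_ : (j == k :> nat) = false) ?mulr0 //; apply/negbTE.
have -> : k = S.+1 by apply/eqP; rewrite eqn_leq kS.
rewrite pS big1 // => j _; rewrite (_ : (j == S.+1 :> nat) = false) ?mulr0 //.
by rewrite ltn_eqF.
Qed.

Hypothesis pS1 : p S.+1 = 0.

(** By [pexp_var] this is the variance of one indicator (or 0 if [n = 0]), hence bounded uniformly
    in [n]. *)
Lemma pexp_fluct2 n k : (k <= S.+1)%N -> pexp p S n (fun s => fluct n k s ^+ 2) <= 1.
Proof.
move=> kS.
have -> : pexp p S n (fun s => fluct n k s ^+ 2) = (Num.sqrt n%:R)^-1 ^+ 2 *
   pexp p S n (fun s => (\sum_(j <- s) (((j == k) : nat)%:R - p k)) ^+ 2).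
  by rewrite -pexpZ; apply: eq_pexp => s sn; rewrite fluctE // -mulr_sumr exprMn.
rewrite (@pexp_var _ p S p1 n (fun j => ((j == k) : nat)%:R - p k)) ?sum_centered //.
have pk1 : 0 <= p k <= 1.
  rewrite p0 /=; have [kS'|kS'] := ltnP k S.+1.
    by rewrite -p1 (bigD1 (Ordinal kS')) //= lerDl sumr_ge0.
  by have -> : k = S.+1; [apply/eqP; rewrite eqn_leq kS|rewrite pS1].
have V : \sum_(j < S.+1) p j * (((j == k :> nat) : nat)%:R - p k) ^+ 2 <= 1.
  rewrite -[leRHS]p1; apply: ler_sum => j _; apply: ler_piMr => //.
  by move/andP: pk1 => [? ?]; case: (_ == _); rewrite /= ?sub0r ?sqrrN exprn_ile1 //; lra.
apply: le_trans V; rewrite mulrA; apply: ler_piMl.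
  by apply: sumr_ge0 => j _; rewrite mulr_ge0 ?sqr_ge0.
have [->|n0] := eqVneq n 0%N; first by rewrite mulr0.
by rewrite exprVn sqr_sqrtr ?ler0n // mulVf // pnatr_eq0.
Qed.

(** Chebyshev's inequality for the sum of squares. A fixed large [L] gives tightness; [L]
    proportional to the square root of [n] shows that the empirical pmf is close to [p] up to
    probability of order [1 / n]. *)
Lemma tight_fluct n (L : R) (B : set (seq nat)) : 0 < L ->
  (forall s, s \in outcomes S n -> B s -> ~ box S.+2 L (fun k => fluct n k s)) ->
  fine (P [set w | B (sample n w)]) <= S.+2%:R / L ^+ 2.
Proof.
move=> L0 Bbox.
apply: (@le_trans _ _ (pexp p S n (fun s => L ^- 2 * \sum_(k < S.+2) fluct n k s ^+ 2))).
  apply: prob_sample_le.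
    move=> s; rewrite mulr_ge0 ?invr_ge0 ?sqr_ge0 //.
    by apply: sumr_ge0 => k _; exact: sqr_ge0.
  move=> s sn /(Bbox _ sn) /existsNP[k /not_implyP[km /negP]]; rewrite -ltNge => kL.
  rewrite mulrC ler_pdivlMr ?exprn_gt0 // mul1r (bigD1 (Ordinal km)) //=.
  apply: ler_wpDr; first by apply: sumr_ge0 => i _; exact: sqr_ge0.
  by rewrite -[leRHS]real_normK ?num_real // ler_sqr ?nnegrE ?(ltW L0) // ltW.
rewrite pexpZ pexp_sum mulrC ler_wpM2r ?invr_ge0 ?sqr_ge0 //.
rewrite -[X in _ <= X%:R]card_ord -sum1_card natr_sum.
by apply: ler_sum => k _; apply: pexp_fluct2; rewrite -ltnS ltn_ord.
Qed.

(** Reduction to one dimension: the dot product with [t] is the normalised sum of [v] over the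
    sample, and under [p] the function [v] is centered with variance [Sig]. *)
Lemma cvg_cf_fluct (t : nat -> R) :
  let Sig := \sum_(i < S.+2) \sum_(j < S.+2) t i * t j * pmf_cov p i j in
  \int[P]_w cos (dot S.+2 t (fun k => fluct n k (sample n w))) @[n --> \oo] -->
     expR (- Sig / 2) /\
  \int[P]_w sin (dot S.+2 t (fun k => fluct n k (sample n w))) @[n --> \oo] --> (0 : R).
Proof.
move=> Sig.
pose v (j : nat) : R := \sum_(k < S.+2) t k * (((j == k) : nat)%:R - p k).
have v0 : \sum_(j < S.+1) p j * v j = 0.
  rewrite /v; under eq_bigr do rewrite mulr_sumr.
  rewrite exchange_big big1 // => k _; under eq_bigr do rewrite mulrCA.
  by rewrite -mulr_sumr sum_centered ?mulr0 // -ltnS ltn_ord.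
have vq : \sum_(j < S.+1) p j * v j ^+ 2 = Sig.
  have cov i k : (i <= S.+1)%N -> (k <= S.+1)%N -> \sum_(j < S.+1) p j *
     ((((j == i :> nat) : nat)%:R - p i) * (((j == k :> nat) : nat)%:R - p k)) = pmf_cov p i k.
    move=> iS kS.
    transitivity (\sum_(j < S.+1) ((j == i :> nat) : nat)%:R *
         (p j * (((j == k :> nat) : nat)%:R - p k))
       - p i * \sum_(j < S.+1) p j * (((j == k :> nat) : nat)%:R - p k)).
      by rewrite mulr_sumr -sumrB; apply: eq_bigr => j _; ring.
    rewrite sum_centered // mulr0 subr0 /pmf_cov.
    have [i1|i1] := ltnP i S.+1.
      rewrite (bigD1 (Ordinal i1)) //= eqxx mul1r big1 ?addr0; first by ring.
      by move=> j jk; rewrite (_ : (j == i :> nat) = false) ?mul0r //; apply/negbTE.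
    have -> : i = S.+1 by apply/eqP; rewrite eqn_leq iS.
    rewrite pS1 mulr0 mul0r subrr big1 // => j _.
    by rewrite (_ : (j == S.+1 :> nat) = false) ?mul0r // ltn_eqF.
  rewrite /Sig.
  transitivity (\sum_(j < S.+1) \sum_(i < S.+2) \sum_(k < S.+2) t i * t k *
     (p j * ((((j == i :> nat) : nat)%:R - p i) * (((j == k :> nat) : nat)%:R - p k)))).
    apply: eq_bigr => j _; rewrite expr2 /v mulr_suml mulr_sumr; apply: eq_bigr => i _.
    by rewrite mulr_sumr mulr_sumr; apply: eq_bigr => k _; ring.
  rewrite exchange_big; apply: eq_bigr => i _.
  rewrite exchange_big; apply: eq_bigr => k _.
  by rewrite -mulr_sumr cov // -ltnS ltn_ord.
have dotE n s : size s = n -> dot S.+2 t (fun k => fluct n k s) =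
    \sum_(j <- s) (Num.sqrt n%:R)^-1 * v j.
  move=> sn; rewrite /dot.
  under eq_bigr do rewrite fluctE // mulr_sumr.
  rewrite exchange_big /=; apply: eq_bigr => j _; rewrite /v mulr_sumr.
  by apply: eq_bigr => k _; rewrite mulrCA.
have [h1 h2] := cvg_cf p0 p1 v0; rewrite -vq; split.
  have -> // : (fun n => \int[P]_w cos (dot S.+2 t (fun k => fluct n k (sample n w)))) =
    (fun n => pexp p S n (fun s => cos (\sum_(j <- s) (Num.sqrt n%:R)^-1 * v j))).
  apply/funext => n.
  rewrite (@Rintegral_sample n (fun s => cos (dot S.+2 t (fun k => fluct n k s))) 1).
    by apply: eq_pexp => s sn; rewrite dotE.
  by move=> s; exact: cos_max.
have -> // : (fun n => \int[P]_w sin (dot S.+2 t (fun k => fluct n k (sample n w)))) =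
    (fun n => pexp p S n (fun s => sin (\sum_(j <- s) (Num.sqrt n%:R)^-1 * v j))).
apply/funext => n.
rewrite (@Rintegral_sample n (fun s => sin (dot S.+2 t (fun k => fluct n k s))) 1).
  by apply: eq_pexp => s sn; rewrite dotE.
by move=> s; exact: sin_max.
Qed.

End sample.

(** * Projection on the cone and the least-squares estimator *)

Section cone_projection.
Context {R : realType}.
Variables (p0 : nat -> R) (S : nat).
Implicit Types (x g h : nat -> R).

Lemma DeltaD g h k : Delta (fun i => g i + h i) k = Delta g k + Delta h k.
Proof. by rewrite /Delta; ring. Qed.

Lemma DeltaB g h k : Delta (fun i => g i - h i) k = Delta g k - Delta h k.
Proof. by rewrite /Delta; ring. Qed.

Lemma DeltaZ a g k : Delta (fun i => a * g i) k = a * Delta g k.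
Proof. by rewrite /Delta; ring. Qed.

Lemma K0_ext g h : (forall k, (k < S.+2)%N -> g k = h k) -> K0 p0 S g -> K0 p0 S h.
Proof.
move=> gh Kg k kS nk; have := Kg k kS nk; move/andP: kS => [k1 kS].
by rewrite /Delta !gh // ?ltnS ?(leq_trans (leq_pred _)) // ltnW.
Qed.

Lemma K0_Z a g : 0 <= a -> K0 p0 S g -> K0 p0 S (fun k => a * g k).
Proof. by move=> a0 Kg k kS nk; rewrite DeltaZ mulr_ge0 // Kg. Qed.

Lemma K0_addcst a g : K0 p0 S g -> K0 p0 S (fun k => g k + a).
Proof.
move=> Kg k kS nk; rewrite (DeltaD g (fun=> a)) addr_ge0 ?Kg //.
by rewrite /Delta; lra.
Qed.

Lemma K0_zero : K0 p0 S (fun=> 0).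
Proof. by move=> k _ _; rewrite /Delta; lra. Qed.

(** Minimise over the part of the closed cone in a box of radius [r] around [x], which is compact. A
    vector outside the box costs more than [r ^+ 2], hence more than the zero vector, which lies in
    the cone and in the box. *)
Lemma proj_K0_exists x : exists g, is_proj_K0 p0 S x g.
Proof.
pose ext (v : 'rV[R]_S.+2) (k : nat) : R := v 0 (inord k).
have extC k : continuous (ext ^~ k) by move=> v; exact: coord_continuous.
have extE g k : (k < S.+2)%N -> ext (\row_i g i) k = g k.
  by move=> kS; rewrite /ext mxE inordK.
pose r := 1 + \sum_(k < S.+2) x k ^+ 2.
have r1 : 1 <= r by rewrite lerDl sumr_ge0 // => k _; exact: sqr_ge0.
pose f (v : 'rV[R]_S.+2) := \sum_(k < S.+2) (ext v k - x k) ^+ 2.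
have fC : continuous f.
  apply: continuous_big; first exact: add_continuous.
  move=> k _ v.
  have h : {for v, continuous (fun v => ext v k - x k)}.
    by apply: continuousB; [exact: extC|exact: cst_continuous].
  exact: (continuousM h h).
pose B := [set v : 'rV[R]_S.+2 | forall i : 'I_S.+2, `[x i - r, x i + r]%classic (v ord0 i)].
have Bc : compact B.
  apply: (@rV_compact R S.+2 (fun i => `[x i - r, x i + r]%classic)) => i.
  exact: segment_compact.
pose C := [set v : 'rV[R]_S.+2 | K0 p0 S (ext v)].
have Cc : closed C.
  have -> : C = \bigcap_(k in [set k | (1 <= k <= S)%N /\ ~ is_knot p0 k])
      ((fun v => Delta (ext v) k) @^-1` [set z | 0 <= z]).
    apply/seteqP; split => v /=; first by move=> Kv k [kS nk]; exact: Kv.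
    by move=> Kv k kS nk; exact: Kv.
  apply: closed_bigI => k _; apply: closed_comp; last exact: closed_ge.
  move=> v _; rewrite /Delta.
  apply: (@continuousD _ _ _ (fun v => ext v k.+1 - 2 * ext v k)); last exact: extC.
  apply: continuousB; first exact: extC.
  by apply: continuousM; [exact: cst_continuous|exact: extC].
pose A := B `&` C.
have Ac : compact A by exact: compact_closedI.
have A0 : A (\row_i 0).
  split; last by apply: K0_ext K0_zero => k kS; rewrite (extE (fun=> 0)).
  move=> i /=; rewrite in_itv /= mxE.
  have : `|x i| <= r.
    have h : x i ^+ 2 <= \sum_(k < S.+2) x k ^+ 2.
      by rewrite (bigD1 i) //= lerDl sumr_ge0 // => k _; exact: sqr_ge0.
    have : `|x i| ^+ 2 <= \sum_(k < S.+2) x k ^+ 2 by rewrite real_normK ?num_real.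
    by rewrite /r; have := normr_ge0 (x i); nra.
  by rewrite ler_norml => /andP[? ?]; apply/andP; split; lra.
have [c] := @EVT_min_rV R S.+2 f A (ex_intro _ _ A0) Ac (continuous_subspaceT fC).
move=> /set_mem[Bc' Cc'] cmin; exists (ext c); split => // g Kg.
have [gB|] := pselect (B (\row_i g i)).
  have gA : A (\row_i g i) by split => //; apply: K0_ext Kg => k kS; rewrite extE.
  apply: le_trans (cmin _ (mem_set gA)) _; rewrite /f.
  by apply: ler_sum => k _; rewrite extE.
move=> /existsNP[i]; rewrite /= in_itv /= mxE => gi.
have ri : r < `|g i - x i|.
  rewrite ltNge; apply/negP; rewrite ler_norml => /andP[? ?]; apply: gi.
  by apply/andP; split; lra.
apply: le_trans (cmin _ (mem_set A0)) _; rewrite /f.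
apply: (@le_trans _ _ (r ^+ 2)).
  apply: (@le_trans _ _ (\sum_(k < S.+2) x k ^+ 2)).
    by apply: ler_sum => k _; rewrite (extE (fun=> 0)) // sub0r sqrrN.
  by have -> : \sum_(k < S.+2) x k ^+ 2 = r - 1; [rewrite /r; ring|nra].
rewrite (bigD1 i) //= ler_wpDr ?sumr_ge0 // => [k _|]; first exact: sqr_ge0.
by rewrite -[leRHS]real_normK ?num_real // ler_sqr ?nnegrE //; lra.
Qed.

Definition proj_K0 x : nat -> R := projT1 (cid (proj_K0_exists x)).

Definition dist_K0 x : R := \sum_(k < S.+2) (proj_K0 x k - x k) ^+ 2.

Lemma proj_K0P x : is_proj_K0 p0 S x (proj_K0 x).
Proof. by rewrite /proj_K0; case: cid. Qed.

Lemma dist_K0_le x g : K0 p0 S g -> dist_K0 x <= \sum_(k < S.+2) (g k - x k) ^+ 2.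
Proof. by case: (proj_K0P x) => _; apply. Qed.

(** Any two minimisers give the same value, so the limit variable is a function of the Gaussian
    vector alone. *)
Lemma is_proj_dist_K0 x g : is_proj_K0 p0 S x g ->
  \sum_(k < S.+2) (g k - x k) ^+ 2 = dist_K0 x.
Proof.
move=> [Kg gmin]; apply/eqP; rewrite eq_le dist_K0_le // andbT.
by apply: gmin; case: (proj_K0P x).
Qed.

Lemma dist_K0Z a x : 0 < a -> dist_K0 (fun k => a * x k) = a ^+ 2 * dist_K0 x.
Proof.
move=> a0; apply/eqP; rewrite eq_le; apply/andP; split.
  apply: le_trans (dist_K0_le _ (K0_Z (ltW a0) (proj1 (proj_K0P x)))) _.
  by rewrite mulr_sumr; apply: ler_sum => k _; rewrite -mulrBr exprMn.
rewrite -ler_pdivlMl ?exprn_gt0 //.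
have a'0 : 0 <= a^-1 by rewrite invr_ge0 ltW.
apply: le_trans (dist_K0_le _ (K0_Z a'0 (proj1 (proj_K0P (fun k => a * x k))))) _.
rewrite mulr_sumr; apply: ler_sum => k _.
by rewrite -exprVn -exprMn mulrBr mulrA mulVf ?mul1r // gt_eqF.
Qed.

Lemma dist_K0_ge0 x : 0 <= dist_K0 x.
Proof. by apply: sumr_ge0 => k _; exact: sqr_ge0. Qed.

Lemma dist_K0_le_norm x : dist_K0 x <= \sum_(k < S.+2) x k ^+ 2.
Proof.
apply: le_trans (dist_K0_le x K0_zero) _.
by apply: ler_sum => k _; rewrite sub0r sqrrN.
Qed.

Lemma proj_K0_dist x k : (k < S.+2)%N -> (proj_K0 x k - x k) ^+ 2 <= dist_K0 x.
Proof.
move=> kS; rewrite /dist_K0 (bigD1 (Ordinal kS)) //= lerDl sumr_ge0 // => i _.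
exact: sqr_ge0.
Qed.

Lemma sum_sqr_box (B : R) x : box S.+2 B x -> \sum_(k < S.+2) x k ^+ 2 <= S.+2%:R * B ^+ 2.
Proof.
move=> xB; rewrite mulr_natl -[X in _ *+ X]card_ord -sumr_const; apply: ler_sum => k _.
have h := xB k (ltn_ord k).
by rewrite -[leLHS]real_normK ?num_real // ler_sqr ?nnegrE // (le_trans _ h).
Qed.

(** The projection of [x] is a competitor at [y]. Expanding the square around [x], the cross term is
    controlled because [proj_K0 x - x] is bounded by [C] on the box; [K] shares [e] among the [S.+2]
    coordinates. *)
Lemma dist_K0_loc_unif_cont : loc_unif_cont S.+2 dist_K0.
Proof.
move=> B e e0.
pose C := 1 + S.+2%:R * B ^+ 2.
have C1 : 1 <= C by rewrite lerDl mulr_ge0 // sqr_ge0.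
pose K : R := S.+2%:R * (2 * C + 1).
have K0' : 0 < K by rewrite mulr_gt0 ?ltr0n //; lra.
exists (Num.min 1 (e / K)); first by rewrite lt_min ltr01 divr_gt0.
have half x y : box S.+2 B x -> (forall k, (k < S.+2)%N -> `|x k - y k| <= Num.min 1 (e / K)) ->
    dist_K0 y - dist_K0 x <= e.
  move=> xB xy; rewrite lerBlDl.
  apply: le_trans (dist_K0_le y (proj1 (proj_K0P x))) _.
  have -> : e = \sum_(k < S.+2) (e / S.+2%:R).
    by rewrite sumr_const card_ord -[_ *+ _]mulr_natr mulrVK // unitfE pnatr_eq0.
  rewrite /dist_K0 -big_split /=; apply: ler_sum => k _.
  have := xy k (ltn_ord k); rewrite le_min => /andP[xy1 xye].
  have px : `|proj_K0 x k - x k| <= C.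
    have h : `|proj_K0 x k - x k| ^+ 2 <= S.+2%:R * B ^+ 2.
      rewrite real_normK ?num_real //; apply: le_trans (proj_K0_dist x (ltn_ord k)) _.
      exact: le_trans (dist_K0_le_norm x) (sum_sqr_box xB).
    by rewrite /C; have := normr_ge0 (proj_K0 x k - x k); nra.
  have -> : proj_K0 x k - y k = (proj_K0 x k - x k) + (x k - y k) by ring.
  rewrite sqrrD -addrA lerD2l.
  apply: (@le_trans _ _ (`|x k - y k| * (2 * C + 1))).
    apply: le_trans (ler_norm _) _; apply: le_trans (ler_normD _ _) _.
    rewrite normrMn normrM normrX mulrDr mulr1; apply: lerD.
      by have := ler_wpM2r (normr_ge0 (x k - y k)) px; lra.
    by rewrite expr2 ler_piMl.
  have : `|x k - y k| * (2 * C + 1) <= e / K * (2 * C + 1) by rewrite ler_wpM2r //; lra.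
  move/le_trans; apply; rewrite /K invfM !mulrA mulrVK //; rewrite unitfE gt_eqF //; lra.
move=> x y xB yB xy; rewrite ler_norml lerNl opprB; apply/andP; split.
  exact: half.
by apply: half => // k kS; rewrite distrC; exact: xy.
Qed.

(** On a box [dist_K0] takes values in the compact interval [[0, C]], around which [f] is uniformly
    continuous. *)
Lemma comp_loc_unif_cont (f : R -> R) : continuous f ->
  loc_unif_cont S.+2 (fun x => f (dist_K0 x)).
Proof.
move=> fc B e e0.
pose C := S.+2%:R * B ^+ 2.
have [dl dl0 Hdl] : exists2 dl : R, 0 < dl & forall y z, `[0, C]%classic y -> `|y - z| < dl ->
    `|f y - f z| <= e.
  have /compact_near_coveringP := @segment_compact R 0 C.
  move=> /(_ _ (0 : R)^'+ (fun dl y => forall z, `|y - z| < dl -> `|f y - f z| <= e) _).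
  have cov : forall y, `[0, C]%classic y -> \forall y' \near y & dl \near (0 : R)^'+,
      forall z, `|y' - z| < dl -> `|f y' - f z| <= e.
    move=> y _.
    have e20 : 0 < e / 2 by lra.
    have /cvgrPdist_le /(_ _ e20) /nbhs_ballP[a /= a0 ha] := fc y.
    exists (ball y (a / 2), [set dl | dl < a / 2]) => /=.
      split; first by apply: nbhsx_ballx; lra.
      by apply: nbhs_right_lt; lra.
    move=> [y' dl] /= [yy' dla] z y'z.
    have h1 : `|f y - f y'| <= e / 2.
      by apply: ha; apply: lt_trans yy' _; lra.
    have h2 : `|f y - f z| <= e / 2.
      apply: ha; rewrite /ball /=.
      have -> : y - z = (y - y') + (y' - z) by ring.
      by apply: le_lt_trans (ler_normD _ _) _; move: yy'; rewrite /ball /=; lra.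
    have -> : f y' - f z = (f y - f z) - (f y - f y') by ring.
    by apply: le_trans (ler_normB _ _) _; lra.
  move=> /(_ cov) H.
  near (0 : R)^'+ => dl; exists dl; first by near: dl; exact: nbhs_right_gt.
  have K : `[0, C]%classic `<=` (fun y => forall z, `|y - z| < dl -> `|f y - f z| <= e).
    by near: dl; exact: H.
  by move=> y z yC; exact: K.
have dl20 : 0 < dl / 2 by lra.
have [d2 d20 Hd2] := dist_K0_loc_unif_cont B dl20.
exists d2 => // x y xB yB xy; apply: Hdl.
  rewrite /= in_itv /= dist_K0_ge0 /=.
  exact: le_trans (dist_K0_le_norm x) (sum_sqr_box xB).
by apply: le_lt_trans (Hd2 _ _ xB yB xy) _; lra.
Unshelve. all: by end_near. Qed.

End cone_projection.

Lemma eseries_finite_support {R : realType} (f : nat -> R) (N : nat) :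
  (forall j, (N <= j)%N -> f j = 0) ->
  (\sum_(0 <= j <oo) (f j)%:E)%E = (\sum_(j < N) f j)%:E.
Proof.
move=> fN; apply: cvg_lim => //; apply: cvg_near_cst; near=> n.
have Nn : (N <= n)%N by near: n; exact: nbhs_infty_ge.
rewrite (@big_cat_nat _ _ _ N) //= [X in (_ + X)%E]big_nat_cond [X in (_ + X)%E]big1 ?adde0.
  by rewrite big_mkord sumEFin.
by move=> j /andP[/andP[Nj _] _]; rewrite fN.
Unshelve. all: by end_near. Qed.

Lemma uniform_positive_lower_bound {R : realType} (a : nat -> R) (N : nat) :
  exists2 eta, 0 < eta & forall k, (k < N)%N -> 0 < a k -> eta <= a k.
Proof.
elim: N => [|N [eta eta0 h]]; first by exists 1.
have [aN|aN] := ltP 0 (a N).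
  exists (Num.min eta (a N)); first by rewrite lt_min eta0.
  move=> k; rewrite ltnS leq_eqVlt => /orP[/eqP->|kN ak].
    by rewrite ge_min lexx orbT.
  by rewrite ge_min h.
exists eta => // k; rewrite ltnS leq_eqVlt => /orP[/eqP->|kN ak]; last exact: h.
by rewrite ltNge aN.
Qed.

(** * The least-squares estimator near [p0] *)

Section least_squares.
Context {R : realType}.
Variables (p0 : nat -> R) (S : nat).
Hypothesis p0_pmf : is_pmf p0.
Hypothesis p0_supp : forall j, 0 < p0 j <-> (j <= S)%N.
Hypothesis p0_convex : convex_seq p0.

Lemma p0_out j : (S < j)%N -> p0 j = 0.
Proof.
move=> Sj; apply/eqP; rewrite eq_le (proj1 p0_pmf) andbT leNgt; apply/negP.
by move=> /p0_supp; rewrite leqNgt Sj.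
Qed.

Lemma p0_sum1 : \sum_(j < S.+1) p0 j = 1.
Proof.
by have := proj2 p0_pmf; rewrite (@eseries_finite_support _ _ S.+1 p0_out) => -[].
Qed.

(** Away from the knots [Delta p0 k] is zero, so only the nonnegative [Delta p k] remains. *)
Lemma convex_pmf_in_K0 p : convex_seq p -> K0 p0 S (fun k => p k - p0 k).
Proof.
move=> pc k /andP[k1 kS] nk; rewrite DeltaB.
have -> : Delta p0 k = 0.
  apply/eqP; rewrite eq_le p0_convex // andbT leNgt; apply/negP => h.
  by apply: nk; split.
by rewrite subr0 pc.
Qed.

Section small_perturbation.
Variable x : nat -> R.
Hypothesis x_sum0 : \sum_(k < S.+2) x k = 0.
Hypothesis xS : x S.+1 = 0.
Let h := proj_K0 p0 S x.

(* Constants lie in the lineality space of K0. *)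
Lemma proj_K0_sum0 : \sum_(k < S.+2) h k = 0.
Proof.
have [Kh hmin] := proj_K0P p0 S x.
pose sg := \sum_(k < S.+2) (h k - x k).
have sgE : sg = \sum_(k < S.+2) h k by rewrite /sg sumrB x_sum0 subr0.
rewrite -sgE; apply/eqP; rewrite -sqrf_eq0 eq_le sqr_ge0 andbT.
have m0 : 0 < S.+2%:R :> R by rewrite ltr0n.
pose t := - sg / S.+2%:R.
have := hmin _ (K0_addcst t Kh).
have -> : \sum_(k < S.+2) (h k + t - x k) ^+ 2 =
   \sum_(k < S.+2) (h k - x k) ^+ 2 + (2 * t * sg + S.+2%:R * t ^+ 2).
  have -> : S.+2%:R * t ^+ 2 = \sum_(k < S.+2) t ^+ 2 by rewrite sumr_const card_ord mulr_natl.
  rewrite /sg mulr_sumr -!big_split /=.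
  by apply: eq_bigr => k _; ring.
rewrite lerDl.
have -> : 2 * t * sg + S.+2%:R * t ^+ 2 = - (sg ^+ 2 / S.+2%:R).
  rewrite /t; move: (S.+2%:R : R) m0 => M m0; field.
  by rewrite gt_eqF.
by rewrite oppr_ge0 pmulr_lle0 // invr_gt0.
Qed.

(* S.+1 enters a single constraint, Delta g S >= 0, with a positive coefficient. *)
Lemma proj_K0_last_ge0 : 0 <= h S.+1.
Proof.
have [Kh hmin] := proj_K0P p0 S x.
rewrite leNgt; apply/negP => hS.
have Kg : K0 p0 S (fun k => if k == S.+1 then 0 else h k).
  move=> k kS nk; apply: le_trans (Kh k kS nk) _; move/andP: kS => [k1 kS].
  have e1 : (k == S.+1) = false by rewrite ltn_eqF // ltnS.
  have e2 : (k.-1 == S.+1) = false by rewrite ltn_eqF // ltnS (leq_trans (leq_pred k)).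
  rewrite /Delta e1 e2.
  by rewrite eqSS; case: eqP => [->|_] //; have := hS; rewrite /h; lra.
have := hmin _ Kg; rewrite big_ord_recr [leRHS]big_ord_recr /= eqxx xS !subr0.
have -> : \sum_(i < S.+1) ((if i == S.+1 :> nat then 0 else h i) - x i) ^+ 2 =
    \sum_(i < S.+1) (h i - x i) ^+ 2.
  by apply: eq_bigr => i _; rewrite ltn_eqF.
by rewrite lerD2l expr0n /= leNgt exprn_even_gt0 //= -/h lt_eqF.
Qed.

Variable eta : R.
Hypothesis h_eta : forall k, (k < S.+2)%N -> `|h k| <= eta.
Hypothesis eta_p0 : forall k, (k < S.+2)%N -> 0 < p0 k -> eta <= p0 k.
Hypothesis eta_Delta : forall k, (k < S.+2)%N -> 0 < Delta p0 k / 4 -> eta <= Delta p0 k / 4.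

Let hx (k : nat) : R := if (k < S.+2)%N then h k else 0.

(** At knots the slack of [p0] absorbs the perturbation; at other [k] up to [S] the cone constraint
    applies. The index [S.+1] is itself a knot, as [p0 S] is positive, and at [S.+2] the only
    contribution is [h S.+1], which is nonnegative. *)
Lemma perturbed_convex : convex_seq (fun k => p0 k + hx k).
Proof.
have eta0 : 0 <= eta by apply: le_trans (h_eta (ltn0Sn _)).
have hx_eta k : `|hx k| <= eta.
  by rewrite /hx; case: ifP => [/h_eta//|_]; rewrite normr0.
move=> k k1; rewrite DeltaD.
have [kS|kS] := ltnP k S.+2; last first.
  rewrite addr_ge0 ?p0_convex // /Delta /hx.
  rewrite !(ltnNge _ S.+2) kS (leqW kS) /= -ltnNge mulr0 subr0 add0r.
  case: ifP => // kS'; rewrite (_ : k.-1 = S.+1) ?proj_K0_last_ge0 //.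
  by apply/eqP; rewrite eqn_leq -ltnS kS' -(ltnS S.+1) prednK.
have [Dk|Dk] := ltP 0 (Delta p0 k).
  (* The coefficients 1, 2, 1 of [Delta] add up to 4, hence the quarter in [eta_Delta]. *)
  have := eta_Delta kS; rewrite divr_gt0 // => /(_ isT).
  rewrite [Delta hx k]/Delta; have := hx_eta k.+1; have := hx_eta k; have := hx_eta k.-1.
  by rewrite !ler_norml => /andP[? ?] /andP[? ?] /andP[? ?]; lra.
have kS' : (1 <= k <= S)%N.
  rewrite k1 /=; move: kS; rewrite ltnS leq_eqVlt => /orP[/eqP kS|//].
  move: Dk; rewrite kS /Delta /= (p0_out (leqnSn S.+1)) (p0_out (ltnSn S)) => Dk.
  by have /p0_supp := leqnn S; lra.
have nk : ~ is_knot p0 k by move=> [_]; rewrite ltNge Dk.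
rewrite addr_ge0 ?p0_convex //; have := (proj1 (proj_K0P p0 S x)) k kS' nk.
move/andP: kS' => [_ kS'].
have b1 : (k.+1 < S.+2)%N by rewrite !ltnS.
by rewrite /Delta /hx b1 (ltnW b1) (leq_ltn_trans (leq_pred k) (ltnW b1)).
Qed.

Lemma perturbed_pmf : is_pmf (fun k => p0 k + hx k).
Proof.
split=> [k|].
  rewrite /hx; case: ifP => kS; last by rewrite addr0 (proj1 p0_pmf).
  have [kS'|kS'] := leqP k S.
    have := eta_p0 kS; rewrite (p0_supp k).2 // => /(_ isT).
    by have := h_eta kS; rewrite ler_norml => /andP[]; lra.
  have -> : k = S.+1 by apply/eqP; rewrite eqn_leq -ltnS kS kS'.
  by rewrite addr_ge0 ?(proj1 p0_pmf) // proj_K0_last_ge0.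
rewrite (@eseries_finite_support _ _ S.+2).
  congr EFin; rewrite big_split /= big_ord_recr /= p0_sum1 p0_out // addr0.
  transitivity (1 + \sum_(k < S.+2) h k); last by rewrite proj_K0_sum0 addr0.
  by congr (_ + _); apply: eq_bigr => k _; rewrite /hx ltn_ord.
by move=> j jS; rewrite /hx ltnNge jS addr0 p0_out // ltnW.
Qed.

End small_perturbation.

Lemma sqnorm_LSE : exists2 c : R, 0 < c & forall q phat,
  (forall j, (S < j)%N -> q j = 0) -> \sum_(j < S.+1) q j = 1 ->
  (forall k, (k < S.+2)%N -> `|q k - p0 k| <= c) ->
  is_convex_LSE q phat ->
  sqnorm (fun j => q j - phat j) = (dist_K0 p0 S (fun k => q k - p0 k))%:E.
Proof.
have [e1 e10 He1] := uniform_positive_lower_bound p0 S.+2.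
have [e2 e20 He2] := uniform_positive_lower_bound (fun k => Delta p0 k / 4) S.+2.
pose eta := Num.min e1 e2.
have eta0 : 0 < eta by rewrite lt_min e10.
(* With deviations at most [c], the projection moves a coordinate by at most [S.+2%:R * c]; adding
   the deviation itself bounds [h k] by [S.+3%:R * c], that is [eta]. *)
exists (eta / S.+3%:R); first by rewrite divr_gt0 // ltr0n.
set c := eta / S.+3%:R => q phat q0 q1 qp [[phat0 phat1] phatc phatmin].
pose x k := q k - p0 k.
have c0 : 0 < c by rewrite divr_gt0 // ltr0n.
have x_sum0 : \sum_(k < S.+2) x k = 0.
  rewrite sumrB big_ord_recr [X in _ - X]big_ord_recr /= p0_sum1 q1.
  by rewrite p0_out // q0 // !addr0 subrr.
have xS : x S.+1 = 0 by rewrite /x q0 // p0_out // subrr.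
pose h := proj_K0 p0 S x.
have h_eta k : (k < S.+2)%N -> `|h k| <= eta.
  move=> kS.
  have hxk : `|h k - x k| <= S.+2%:R * c.
    suff : `|h k - x k| ^+ 2 <= (S.+2%:R * c) ^+ 2.
      by rewrite ler_sqr ?nnegrE // mulr_ge0 // ltW.
    rewrite real_normK ?num_real //; apply: le_trans (proj_K0_dist p0 x kS) _.
    apply: le_trans (dist_K0_le_norm p0 S x) _.
    apply: le_trans (sum_sqr_box qp) _; rewrite [leRHS]exprMn ler_wpM2r ?sqr_ge0 //.
    by rewrite expr2 ler_peMl // ler1n.
  have -> : eta = S.+2%:R * c + c.
    by rewrite -[X in _ + X]mul1r -mulrDl natr1 /c mulrC mulrVK // unitfE pnatr_eq0.
  have -> : h k = (h k - x k) + x k by ring.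
  by apply: le_trans (ler_normD _ _) _; apply: lerD => //; exact: qp.
have He1' k : (k < S.+2)%N -> 0 < p0 k -> eta <= p0 k.
  by move=> kS pk; rewrite ge_min He1.
have He2' k : (k < S.+2)%N -> 0 < Delta p0 k / 4 -> eta <= Delta p0 k / 4.
  by move=> kS pk; rewrite ge_min He2 ?orbT.
have pp := perturbed_pmf x_sum0 xS h_eta He1'.
have pc := perturbed_convex xS h_eta He2'.
apply/eqP; rewrite eq_le; apply/andP; split.
  apply: le_trans (phatmin _ pp pc) _; rewrite /sqnorm (@eseries_finite_support _ _ S.+2).
    rewrite lee_fin; apply: ler_sum => k _; rewrite ltn_ord -/x -/h -sqrrN.
    by rewrite le_eqVlt; apply/orP; left; apply/eqP; congr (_ ^+ 2); rewrite /x; ring.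
  by move=> j jS; rewrite ltnNge jS addr0 p0_out ?q0 ?subrr ?expr0n // ltnW.
(* [phat] may have a longer support than [S.+2] entries; its tail only increases the norm. *)
apply: (@le_trans _ _ (\sum_(k < S.+2) (q k - phat k) ^+ 2)%:E).
  rewrite lee_fin; apply: le_trans (dist_K0_le _ (convex_pmf_in_K0 phatc)) _.
  apply: ler_sum => k _; rewrite -sqrrN le_eqVlt; apply/orP; left; apply/eqP.
  by congr (_ ^+ 2); ring.
rewrite -sumEFin -(big_mkord xpredT (fun k => ((q k - phat k) ^+ 2)%:E)).
by apply: nneseries_lim_ge => k _ _; rewrite lee_fin sqr_ge0.
Qed.

End least_squares.

(** Makes the statistic a function of the data alone, whichever minimiser is chosen at each sample
    point; its measurability rests on this. *)
Lemma sqnorm_LSE_unique {R : realType} (q p1 p2 : nat -> R) :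
  is_convex_LSE q p1 -> is_convex_LSE q p2 ->
  sqnorm (fun j => q j - p1 j) = sqnorm (fun j => q j - p2 j).
Proof.
move=> [a1 b1 c1] [a2 b2 c2]; apply/eqP; rewrite eq_le.
by rewrite c1 // c2.
Qed.

(** * Convergence in law of the test statistic *)

Unset Implicit Arguments.

Theorem theorem1 (R : realType) (p0 : nat -> R) (S : nat)
  (d : measure_display) (T : measurableType d) (P : probability T R)
  (X : nat -> T -> nat) (phat : nat -> T -> nat -> R)
  (d' : measure_display) (T' : measurableType d') (Q : probability T' R)
  (g0 : nat -> T' -> R) (ghat0 : T' -> nat -> R) :
  (0 < S)%N ->
  is_pmf p0 ->
  (forall j, 0 < p0 j <-> (j <= S)%N) ->
  convex_seq p0 ->
  iid_pmf P X p0 ->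
  (forall n w, (0 < n)%N -> is_convex_LSE (empirical_pmf X n w) (phat n w)) ->
  centered_gaussian_vector Q S.+2 g0 (pmf_cov p0) ->
  (forall w, is_proj_K0 p0 S (fun k => g0 k w) (ghat0 w)) ->
  forall f : R -> R, continuous f -> (exists M : R, forall x, `|f x| <= M) ->
  (fun n : nat =>
     (\int[P]_w (f (n%:R * fine (sqnorm (fun j => empirical_pmf X n w j - phat n w j))))%:E)%E)
    @ \oo --> (\int[Q]_w (f (\sum_(k < S.+2) (ghat0 w k - g0 k w) ^+ 2))%:E)%E.
Proof.
move=> _ p0_pmf p0_supp p0_convex iid LSE [mg0 cf0] projg f fc [M fM].
have pge0 := proj1 p0_pmf.
have psum1 := p0_sum1 p0_pmf p0_supp.
have pS1 : p0 S.+1 = 0 by apply: (p0_out p0_pmf p0_supp).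
have M0 : 0 <= M by apply: le_trans (fM 0).
pose Y n k w := fluct p0 n k (sample X n w).
pose F x := f (dist_K0 p0 S x).
have FM x : `|F x| <= M by exact: fM.
have Fc : loc_unif_cont S.+2 F by exact: comp_loc_unif_cont.
have mY n k : (k < S.+2)%N -> measurable_fun setT (Y n k).
  by move=> _; exact: (measurable_fun_sample iid n (fluct p0 n k)).
have tightY (e : R) : 0 < e -> exists2 L0, 0 < L0 &
    forall n L, L0 <= L -> fine (P [set w | ~ box S.+2 L ((Y n)^~ w)]) <= e.
  (* The summand 1 ensures [L <= L ^+ 2], so that [S.+2%:R / L ^+ 2] is at most [S.+2%:R / L], hence
     at most [e]. *)
  move=> e0; pose L0 := 1 + S.+2%:R / e.
  have se : 0 < S.+2%:R / e by rewrite divr_gt0 // ltr0n.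
  exists L0; first by rewrite addr_gt0.
  move=> n L LL.
  have L1 : 1 <= L by apply: le_trans LL; rewrite lerDl ltW.
  apply: le_trans (tight_fluct iid pge0 psum1 pS1 (n := n) (L := L)
    (B := fun s => ~ box S.+2 L (fun k => fluct p0 n k s)) _ _) _ => //; first lra.
  rewrite ler_pdivrMr ?exprn_gt0 //; last lra.
  apply: (@le_trans _ _ (e * L)).
    by rewrite -ler_pdivrMl // mulrC; apply: le_trans LL; rewrite /L0; lra.
  by rewrite ler_pM2l // expr2 ler_peMl //; lra.
have cvgF : \int[P]_w F ((Y n)^~ w) @[n --> \oo] --> \int[Q]_w F (g0^~ w).
  apply: (levy_continuity mY mg0 tightY _ _ FM Fc) => t.
    have [h _] := cvg_cf_fluct iid pge0 psum1 pS1 t.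
    by rewrite {2}/Rintegral (cf0 t).1.
  have [_ h] := cvg_cf_fluct iid pge0 psum1 pS1 t.
  by rewrite {2}/Rintegral (cf0 t).2.
pose D n w := n%:R * fine (sqnorm (fun j => empirical_pmf X n w j - phat n w j)).
(* No measurability of [phat] is given, so [D n] is shown to factor through the sample. At [n = 0],
   where [phat] is unconstrained, the factor [n] makes [D] zero. *)
have DE n w w' : sample X n w = sample X n w' -> D n w = D n w'.
  rewrite /D; case: n => [|n] ss; first by rewrite !mul0r.
  have qq : empirical_pmf (R := R) X n.+1 w = empirical_pmf X n.+1 w'.
    by apply/funext => k; rewrite !empirical_sample ss.
  congr (_ * fine _); rewrite qq; apply: sqnorm_LSE_unique; last exact: LSE.
  by rewrite -qq; exact: LSE.
have mD n : measurable_fun setT (fun w => f (D n w)).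
  pose H s := if pselect (exists w, sample X n w = s) is left e
    then f (D n (projT1 (cid e))) else 0.
  have -> : (fun w => f (D n w)) = (fun w => H (sample X n w)).
    apply/funext => w; rewrite /H; case: pselect => [e|[]]; last by exists w.
    by congr f; apply: DE; rewrite (projT2 (cid e)).
  exact: measurable_fun_sample iid n H.
have [c c0 Hc] := sqnorm_LSE p0_pmf p0_supp p0_convex.
have close n : (0 < n)%N ->
    `|\int[P]_w f (D n w) - \int[P]_w F ((Y n)^~ w)| <= 2 * M * S.+2%:R / c ^+ 2 / n%:R.
  move=> n0; have n0' : 0 < n%:R :> R by rewrite ltr0n.
  have sn0 : 0 < Num.sqrt n%:R :> R by rewrite sqrtr_gt0.
  (* Fluctuations in the box of radius [L] mean that the empirical pmf is within [c] of [p0], which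
     is what [Hc] requires. *)
  pose L := c * Num.sqrt n%:R; have L0 : 0 < L by rewrite mulr_gt0.
  pose bad s := ~ (s \in outcomes S n /\ box S.+2 L (fun k => fluct p0 n k s)).
  apply: (@le_trans _ _ (0 + 2 * M * fine (P [set w | bad (sample X n w)]))).
    apply: Rintegral_dist_le => //.
    - exact: (measurable_loc_unif_cont (mY n) FM Fc).
    - exact: (measurable_sample iid n bad).
    move=> w /contrapT [so sL]; rewrite normr_le0 subr_eq0; apply/eqP; congr f.
    have := so; rewrite mem_outcomes => /andP[/eqP ssz /allP sS].
    rewrite /D (Hc _ (phat n w)).
    (* Homogeneity of the cone moves the factor [n] inside as the square root of [n] on the
       vector. *)
    - rewrite /= -[X in X * _](@sqr_sqrtr _ n%:R) ?ltW // -dist_K0Z //.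
      by congr dist_K0; apply/funext => k; rewrite /Y /fluct empirical_sample.
    - move=> j Sj; rewrite empirical_sample big_seq big1 ?mulr0 // => i /sS iS.
      by rewrite (_ : (i == j) = false) // ltn_eqF // (leq_ltn_trans iS).
    - under eq_bigr do rewrite empirical_sample.
      rewrite -mulr_sumr exchange_big /= big_seq.
      under eq_bigr => i si.
        rewrite (bigD1 (Ordinal (sS _ si : (i < S.+1)%N))) //= eqxx big1 ?addr0; last first.
          by move=> j ji; rewrite (_ : (i == j) = false) //; apply/negbTE; rewrite eq_sym.
        over.
      by rewrite -big_seq big_const_seq count_predT ssz iter_addr_0 mulVf // gt_eqF.
    - move=> k kS; have := sL k kS.
      rewrite /fluct -empirical_sample normrM gtr0_norm // /L mulrC.
      by rewrite ler_pM2r.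
    exact: LSE.
  rewrite add0r -!mulrA ler_wpM2l // ler_wpM2l //.
  apply: le_trans (tight_fluct iid pge0 psum1 pS1 L0 _) _.
    by move=> s so /= h1 h2; apply: h1.
  by rewrite /L exprMn sqr_sqrtr ?(ltW n0') // invfM.
have cvgD : \int[P]_w f (D n w) @[n --> \oo] --> \int[Q]_w F (g0^~ w).
  have c_cvg : 2 * M * S.+2%:R / c ^+ 2 / n%:R @[n --> \oo] --> (0 : R).
    rewrite -[X in _ --> X](mulr0 (2 * M * S.+2%:R / c ^+ 2)).
    apply: cvgM; first exact: cvg_cst.
    apply/gtr0_cvgV0; last exact: cvgr_idn.
    by near=> n; rewrite ltr0n; near: n; exact: nbhs_infty_gt.
  apply/cvgrPdist_le => e e0; near=> n.
  have n0 : (0 < n)%N by near: n; exact: nbhs_infty_gt.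
  have h1 : `|\int[Q]_w F (g0^~ w) - \int[P]_w F ((Y n)^~ w)| <= e / 2.
    by near: n; move/cvgrPdist_le: cvgF; apply; lra.
  have h2 : `|0 - 2 * M * S.+2%:R / c ^+ 2 / n%:R| <= e / 2.
    by near: n; move/cvgrPdist_le: c_cvg; apply; lra.
  have h3 := le_trans (close n n0) (le_trans (ler_norm _) _).
  rewrite sub0r normrN in h2.
  move: (h3 _ h2) h1; rewrite !ler_norml => /andP[? ?] /andP[? ?].
  by apply/andP; split; lra.
have -> : (\int[Q]_w (f (\sum_(k < S.+2) (ghat0 w k - g0 k w) ^+ 2))%:E)%E =
    (\int[Q]_w F (g0^~ w))%:E.
  rewrite -(EFin_Rintegral Q (measurable_loc_unif_cont mg0 FM Fc) (fun w => FM _)).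
  by apply: eq_integral => w _; rewrite (is_proj_dist_K0 (projg w)).
apply/fine_cvgP; split.
  by near=> n; rewrite (EFin_Rintegral P (mD n) (fun w => fM _)).
exact: cvgD.
Unshelve. all: by end_near. Qed.
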